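(* Let $N^{2n+1}(\rho)$ be a cosymplectic space form with structure $(\varphi,\xi,\eta,\langle,\rangle)$ and constant $\varphi$-sectional curvature $\rho$, and let $\Sigma^2$ be an immersed pmc surface in $N^{2n+1}(\rho)$ with second fundamental form $\sigma$ and mean curvature vector $H$. Then the $(2,0)$-part of the quadratic form $Q$ defined on $\Sigma^2$ by $$Q(X,Y)=8|H|^2\langle\sigma(X,Y),H\rangle-\rho|H|^2\eta(X)\eta(Y)+3\rho\langle\varphi X,H\rangle\langle\varphi Y,H\rangle$$ is holomorphic.
   Context: An almost contact metric structure on an odd-dimensional manifold $N^{2n+1}$ is $(\varphi,\xi,\eta,\langle,\rangle)$, where $\varphi$ is a $(1,1)$-tensor field, $\xi$ a (unit) vector field, $\eta$ its dual 1-form ($\eta(U)=\langle U,\xi\rangle$) and $\langle,\rangle$ a Riemannian metric with $\varphi^2U=-U+\eta(U)\xi$ and $\langle\varphi U,\varphi V\rangle=\langle U,V\rangle-\eta(U)\eta(V)$. It is cosymplectic if $\nabla^N\varphi=0$, where $\nabla^N$ is the Levi-Civita connection (then $\xi$ and $\eta$ are also parallel). A cosymplectic manifold is a cosymplectic space form $N(\rho)$ if every 2-plane spanned by $U,\varphi U$, with $U$ a unit vector orthogonal to $\xi$, has the same constant sectional curvature $\rho$; its curvature tensor is then $$R^N(U,V)W=\tfrac{\rho}{4}\{\langle V,W\rangle U-\langle U,W\rangle V+\langle U,\varphi W\rangle\varphi V-\langle V,\varphi W\rangle\varphi U+2\langle U,\varphi V\rangle\varphi W+\eta(U)\eta(W)V-\eta(V)\eta(W)U+\langle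 U,W\rangle\eta(V)\xi-\langle V,W\rangle\eta(U)\xi\}.$$ For an immersed surface $\Sigma^2$, $\sigma$ is the second fundamental form, $H=\frac12\mathrm{trace}\,\sigma$ the mean curvature vector, and $\nabla^\perp$ the normal connection. $\Sigma^2$ is a pmc surface if $\nabla^\perp H=0$. For local isothermal coordinates $(u,v)$ on $\Sigma^2$ (metric $\lambda^2(du^2+dv^2)$), put $z=u+iv$, $Z=\frac1{\sqrt2}\left(\frac{\partial}{\partial u}-i\frac{\partial}{\partial v}\right)$, and $\widehat Z=\frac1{\sqrt2}\left(\frac{\partial}{\partial u}+i\frac{\partial}{\partial v}\right)$. The $(2,0)$-part of a real symmetric quadratic form $Q$ (extended complex bilinearly) is the quadratic differential locally given by $Q(Z,Z)\,dz^2$; it is holomorphic if $\widehat Z(Q(Z,Z))=0$. *)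

(* Defs.v *)
From HB Require Import structures.
From mathcomp Require Import all_boot all_order all_algebra.
From mathcomp Require Import complex.
From mathcomp Require Import boolp classical_sets functions reals.
From mathcomp Require Import topology normedtype landau derive.

Set Implicit Arguments.
Unset Strict Implicit.
Unset Printing Implicit Defensive.

Import Order.TTheory GRing.Theory Num.Theory numFieldNormedType.Exports.
Local Open Scope classical_set_scope.
Local Open Scope ring_scope.

Definition ebasis (R : realType) (k : nat) (i : 'I_k) : 'rV[R]_k :=
  delta_mx 0 i.

Definition bform (R : realType) (m : nat) (A : 'M[R]_m) (u v : 'rV[R]_m) : R :=
  (u *m A *m v^T) 0 0.

(* C^r in terms of iterated partial derivatives; meant for open U, where the
   values of f outside U play no role. *)
Fixpoint Ck_on (R : realType) (k : nat) (W : normedModType R) (r : nat)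
    (U : set 'rV[R]_k) (f : 'rV[R]_k -> W) : Prop :=
  match r with
  | 0%N => forall x, U x -> {for x, continuous f}
  | r'.+1 => (forall x, U x -> {for x, continuous f}) /\
      (forall i : 'I_k, (forall x, U x -> derivable f x (ebasis R i)) /\
                        Ck_on r' U (fun x => 'D_(ebasis R i) f x))
  end.

Definition smooth_on (R : realType) (k : nat) (W : normedModType R)
    (U : set 'rV[R]_k) (f : 'rV[R]_k -> W) : Prop :=
  forall r : nat, Ck_on r U f.

(* cmap and cinv are total functions; only cmap on cdom and cinv on the image
   of cdom are meaningful. *)
Record chart (R : realType) (m : nat) (M : topologicalType) := Chart {
  cdom : set M;
  cmap : M -> 'rV[R]_m;
  cinv : 'rV[R]_m -> M;
  cdom_open : open cdom;
  cimg_open : open (cmap @` cdom);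
  cmapK : forall p, cdom p -> cinv (cmap p) = p;
  cmap_continuous : forall p, cdom p -> {for p, continuous cmap};
  cinv_continuous : forall x, (cmap @` cdom) x -> {for x, continuous cinv}
}.

Definition cimg (R : realType) (m : nat) (M : topologicalType)
    (c : chart R m M) : set 'rV[R]_m := cmap c @` cdom c.

Definition transition (R : realType) (m : nat) (M : topologicalType)
    (c d : chart R m M) : 'rV[R]_m -> 'rV[R]_m := cmap d \o cinv c.

Definition overlap (R : realType) (m : nat) (M : topologicalType)
    (c d : chart R m M) : set 'rV[R]_m := cmap c @` (cdom c `&` cdom d).

Definition compatible (R : realType) (m : nat) (M : topologicalType)
    (c d : chart R m M) : Prop :=
  smooth_on (overlap c d) (transition c d) /\
  smooth_on (overlap d c) (transition d c).

(* The smooth structure is a maximal atlas, so that atlas c means that c is any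
   system of local coordinates. *)
Record manifold (R : realType) (m : nat) := Manifold {
  points :> topologicalType;
  points_hausdorff : hausdorff_space points;
  points_second_countable : @second_countable points;
  atlas : set (chart R m points);
  atlas_cover : forall p, exists2 c, atlas c & cdom c p;
  atlas_compatible : forall c d, atlas c -> atlas d -> compatible c d;
  atlas_maximal : forall c, (forall d, atlas d -> compatible c d) -> atlas c
}.

(* Tensor fields are families of components, one for each coordinate system,
   subject to the usual transformation rules. *)
Record riemannian_metric (R : realType) (m : nat) (N : manifold R m) :=
  RiemannianMetric {
  gmx :> chart R m N -> 'rV[R]_m -> 'M[R]_m;
  gmx_smooth : forall c, atlas c -> smooth_on (cimg c) (gmx c);
  gmx_change : forall c d, atlas c -> atlas d ->
    forall x, overlap c d x -> forall u v : 'rV[R]_m,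
      bform (gmx c x) u v =
      bform (gmx d (transition c d x))
        ('D_u (transition c d) x) ('D_v (transition c d) x);
  gmx_sym : forall c, atlas c -> forall x, cimg c x -> (gmx c x)^T = gmx c x;
  gmx_pos : forall c, atlas c -> forall x, cimg c x ->
    forall u : 'rV[R]_m, u != 0 -> 0 < bform (gmx c x) u u
}.

(* Tangent vectors are row vectors, so the endomorphism phi with matrix A acts
   by u |-> u *m A. The form eta is the dual of xi, see eta_at below. *)
Record almost_contact_tensors (R : realType) (m : nat) (N : manifold R m) :=
  AlmostContactTensors {
  phimx : chart R m N -> 'rV[R]_m -> 'M[R]_m;
  xivec : chart R m N -> 'rV[R]_m -> 'rV[R]_m;
  phimx_smooth : forall c, atlas c -> smooth_on (cimg c) (phimx c);
  xivec_smooth : forall c, atlas c -> smooth_on (cimg c) (xivec c);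
  phimx_change : forall c d, atlas c -> atlas d ->
    forall x, overlap c d x -> forall u : 'rV[R]_m,
      'D_(u *m phimx c x) (transition c d) x =
      'D_u (transition c d) x *m phimx d (transition c d x);
  xivec_change : forall c d, atlas c -> atlas d ->
    forall x, overlap c d x ->
      'D_(xivec c x) (transition c d) x = xivec d (transition c d x)
}.

Definition eta_at (R : realType) (m : nat) (N : manifold R m)
    (g : riemannian_metric N) (S : almost_contact_tensors N)
    (c : chart R m N) (x u : 'rV[R]_m) : R :=
  bform (g c x) u (xivec S c x).

Definition almost_contact_metric (R : realType) (m : nat) (N : manifold R m)
    (g : riemannian_metric N) (S : almost_contact_tensors N) : Prop :=
  forall c, atlas c -> forall x, cimg c x ->
  [/\ bform (g c x) (xivec S c x) (xivec S c x) = 1,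
      forall u : 'rV[R]_m,
        u *m phimx S c x *m phimx S c x =
        - u + eta_at g S c x u *: xivec S c x &
      forall u v : 'rV[R]_m,
        bform (g c x) (u *m phimx S c x) (v *m phimx S c x) =
        bform (g c x) u v - eta_at g S c x u * eta_at g S c x v].

(* Gamma(u, v)^k = 1/2 sum_l g^(kl) (u^i v^j) (d_i g_jl + d_j g_il - d_l g_ij) *)
Definition christoffel (R : realType) (m : nat) (g : 'rV[R]_m -> 'M[R]_m)
    (x u v : 'rV[R]_m) : 'rV[R]_m :=
  (\row_l (2^-1 * (bform ('D_u g x) v (ebasis R l)
                   + bform ('D_v g x) u (ebasis R l)
                   - bform ('D_(ebasis R l) g x) u v))) *m invmx (g x).

Definition nabla (R : realType) (m : nat) (g : 'rV[R]_m -> 'M[R]_m)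
    (X Y : 'rV[R]_m -> 'rV[R]_m) (x : 'rV[R]_m) : 'rV[R]_m :=
  'D_(X x) Y x + christoffel g x (X x) (Y x).

Definition lie_bracket (R : realType) (m : nat)
    (X Y : 'rV[R]_m -> 'rV[R]_m) (x : 'rV[R]_m) : 'rV[R]_m :=
  'D_(X x) Y x - 'D_(Y x) X x.

Definition curvature (R : realType) (m : nat) (g : 'rV[R]_m -> 'M[R]_m)
    (X Y W : 'rV[R]_m -> 'rV[R]_m) (x : 'rV[R]_m) : 'rV[R]_m :=
  nabla g X (nabla g Y W) x - nabla g Y (nabla g X W) x
  - nabla g (lie_bracket X Y) W x.

(* The vectors u, v at x are extended to fields with constant components;
   the curvature is tensorial, so the choice of extension is immaterial. *)
Definition sectional_curvature (R : realType) (m : nat)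
    (g : 'rV[R]_m -> 'M[R]_m) (x u v : 'rV[R]_m) : R :=
  bform (g x) (curvature g (fun=> u) (fun=> v) (fun=> v) x) u /
  (bform (g x) u u * bform (g x) v v - bform (g x) u v ^+ 2).

Definition cosymplectic (R : realType) (m : nat) (N : manifold R m)
    (g : riemannian_metric N) (S : almost_contact_tensors N) : Prop :=
  almost_contact_metric g S /\
  forall c, atlas c -> forall X Y : 'rV[R]_m -> 'rV[R]_m,
    smooth_on (cimg c) X -> smooth_on (cimg c) Y ->
    forall x, cimg c x ->
      nabla (g c) X (fun y => Y y *m phimx S c y) x
      - nabla (g c) X Y x *m phimx S c x = 0.

Definition cosymplectic_space_form (R : realType) (m : nat) (N : manifold R m)
    (g : riemannian_metric N) (S : almost_contact_tensors N) (rho : R) : Prop :=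
  cosymplectic g S /\
  forall c, atlas c -> forall x, cimg c x -> forall u : 'rV[R]_m,
    bform (g c x) u u = 1 -> bform (g c x) u (xivec S c x) = 0 ->
    sectional_curvature (g c) x u (u *m phimx S c x) = rho.

Definition local_map (R : realType) (k m : nat) (Sig : manifold R k)
    (N : manifold R m) (f : Sig -> N) (s : chart R k Sig) (c : chart R m N)
    : 'rV[R]_k -> 'rV[R]_m := cmap c \o f \o cinv s.

Definition local_dom (R : realType) (k m : nat) (Sig : manifold R k)
    (N : manifold R m) (f : Sig -> N) (s : chart R k Sig) (c : chart R m N)
    : set 'rV[R]_k := cmap s @` (cdom s `&` f @^-1` cdom c).

Definition immersion (R : realType) (k m : nat) (Sig : manifold R k)
    (N : manifold R m) (f : Sig -> N) : Prop :=
  continuous f /\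
  forall s c, atlas s -> atlas c ->
    smooth_on (local_dom f s c) (local_map f s c) /\
    forall y, local_dom f s c y ->
      forall X : 'rV[R]_k, X != 0 -> 'D_X (local_map f s c) y != 0.

(* In the next definitions g is the ambient metric in a coordinate system, F a
   local expression of the immersion, and X, Y : 'rV_2 are the components of
   tangent vectors of the surface, so that 'D_X F y is the image of X in the
   ambient tangent space. *)

Definition induced_metric (R : realType) (m : nat) (g : 'rV[R]_m -> 'M[R]_m)
    (F : 'rV[R]_2 -> 'rV[R]_m) (y X Y : 'rV[R]_2) : R :=
  bform (g (F y)) ('D_X F y) ('D_Y F y).

Definition inv_gram (R : realType) (m : nat) (g : 'rV[R]_m -> 'M[R]_m)
    (F : 'rV[R]_2 -> 'rV[R]_m) (y : 'rV[R]_2) : 'M[R]_2 :=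
  invmx (\matrix_(i, j) induced_metric g F y (ebasis R i) (ebasis R j)).

Definition normal_part (R : realType) (m : nat) (g : 'rV[R]_m -> 'M[R]_m)
    (F : 'rV[R]_2 -> 'rV[R]_m) (y : 'rV[R]_2) (w : 'rV[R]_m) : 'rV[R]_m :=
  w - \sum_(i < 2) \sum_(j < 2)
        (inv_gram g F y i j * bform (g (F y)) w ('D_(ebasis R i) F y))
          *: 'D_(ebasis R j) F y.

Definition nabla_along (R : realType) (m : nat) (g : 'rV[R]_m -> 'M[R]_m)
    (F : 'rV[R]_2 -> 'rV[R]_m) (X : 'rV[R]_2) (V : 'rV[R]_2 -> 'rV[R]_m)
    (y : 'rV[R]_2) : 'rV[R]_m :=
  'D_X V y + christoffel g (F y) ('D_X F y) (V y).

(* sigma(X, Y) is the normal part of the ambient derivative along X of the field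
   with constant components Y; being tensorial it needs no other extension. *)
Definition second_fundamental_form (R : realType) (m : nat)
    (g : 'rV[R]_m -> 'M[R]_m) (F : 'rV[R]_2 -> 'rV[R]_m) (y X Y : 'rV[R]_2)
    : 'rV[R]_m :=
  normal_part g F y (nabla_along g F X (fun z => 'D_Y F z) y).

Definition mean_curvature (R : realType) (m : nat) (g : 'rV[R]_m -> 'M[R]_m)
    (F : 'rV[R]_2 -> 'rV[R]_m) (y : 'rV[R]_2) : 'rV[R]_m :=
  2^-1 *: \sum_(i < 2) \sum_(j < 2)
    inv_gram g F y i j
      *: second_fundamental_form g F y (ebasis R i) (ebasis R j).

Definition nabla_perp (R : realType) (m : nat) (g : 'rV[R]_m -> 'M[R]_m)
    (F : 'rV[R]_2 -> 'rV[R]_m) (X : 'rV[R]_2) (V : 'rV[R]_2 -> 'rV[R]_m)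
    (y : 'rV[R]_2) : 'rV[R]_m :=
  normal_part g F y (nabla_along g F X V y).

Definition pmc_surface (R : realType) (m : nat) (Sig : manifold R 2)
    (N : manifold R m) (g : riemannian_metric N) (f : Sig -> N) : Prop :=
  immersion f /\
  forall s c, atlas s -> atlas c -> forall y, local_dom f s c y ->
    forall X : 'rV[R]_2,
      nabla_perp (g c) (local_map f s c) X
        (mean_curvature (g c) (local_map f s c)) y = 0.

Definition isothermal (R : realType) (m : nat) (Sig : manifold R 2)
    (N : manifold R m) (g : riemannian_metric N) (f : Sig -> N)
    (s : chart R 2 Sig) : Prop :=
  exists2 lambda : 'rV[R]_2 -> R,
    (forall y, cimg s y -> 0 < lambda y) &
    forall c, atlas c -> forall y, local_dom f s c y ->
    forall X Y : 'rV[R]_2,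
      induced_metric (g c) (local_map f s c) y X Y =
      lambda y ^+ 2 * (X 0 0 * Y 0 0 + X 0 1 * Y 0 1).

(* A complexified tangent vector a d/du + b d/dv is the row (a, b). *)
Definition Zvec (R : realType) : 'rV[R[i]]_2 :=
  \row_(j < 2) (((Num.sqrt 2)^-1)%:C%C * (if j == 0 then 1 else (0 -i* 1)%C)).

Definition Zhatvec (R : realType) : 'rV[R[i]]_2 :=
  \row_(j < 2) (((Num.sqrt 2)^-1)%:C%C * (if j == 0 then 1 else (0 +i* 1)%C)).

Definition complex_bilinear_ext (R : realType)
    (Q : 'rV[R]_2 -> 'rV[R]_2 -> R) (A B : 'rV[R[i]]_2) : R[i] :=
  \sum_(j < 2) \sum_(k < 2) A 0 j * B 0 k * (Q (ebasis R j) (ebasis R k))%:C%C.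

Definition complex_deriv (R : realType) (A : 'rV[R[i]]_2)
    (h : 'rV[R]_2 -> R[i]) (y : 'rV[R]_2) : R[i] :=
  \sum_(j < 2) A 0 j *
    ('D_(ebasis R j) (fun z => complex.Re (h z)) y
       +i* 'D_(ebasis R j) (fun z => complex.Im (h z)) y)%C.

Definition holomorphic_on (R : realType) (U : set 'rV[R]_2)
    (h : 'rV[R]_2 -> R[i]) : Prop :=
  forall y, U y ->
  [/\ differentiable (fun z => complex.Re (h z)) y,
      differentiable (fun z => complex.Im (h z)) y &
      complex_deriv (Zhatvec R) h y = 0].

(* Q s c y X Y is the value of a quadratic form of the surface, computed in the
   chart s of the surface and the chart c of the ambient manifold, at the point
   with coordinates y. *)
Definition holomorphic_20_part (R : realType) (m : nat) (Sig : manifold R 2)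
    (N : manifold R m) (g : riemannian_metric N) (f : Sig -> N)
    (Q : chart R 2 Sig -> chart R m N ->
         'rV[R]_2 -> 'rV[R]_2 -> 'rV[R]_2 -> R) : Prop :=
  forall s c, atlas s -> isothermal g f s -> atlas c ->
    holomorphic_on (local_dom f s c)
      (fun y => complex_bilinear_ext (Q s c y) (Zvec R) (Zvec R)).

Definition Qform (R : realType) (m : nat) (Sig : manifold R 2)
    (N : manifold R m) (g : riemannian_metric N) (S : almost_contact_tensors N)
    (rho : R) (f : Sig -> N) (s : chart R 2 Sig) (c : chart R m N)
    (y X Y : 'rV[R]_2) : R :=
  let F := local_map f s c in
  let ip := bform (g c (F y)) in
  let eta := eta_at g S c (F y) in
  let phi := fun u : 'rV[R]_m => u *m phimx S c (F y) in
  let H := mean_curvature (g c) F y in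
  let sigma := second_fundamental_form (g c) F y in
  8 * ip H H * ip (sigma X Y) H
  - rho * ip H H * eta ('D_X F y) * eta ('D_Y F y)
  + 3 * rho * ip (phi ('D_X F y)) H * ip (phi ('D_Y F y)) H.

(* Main.v *)
From HB Require Import structures.
Require Import Defs.
From mathcomp Require Import all_boot all_order all_algebra.
From mathcomp Require Import complex ring lra.
From mathcomp Require Import boolp classical_sets functions reals.
From mathcomp Require Import topology normedtype landau derive.

Set Implicit Arguments.
Unset Strict Implicit.
Unset Printing Implicit Defensive.

(** In a chart the tensors become matrix-valued functions and the
    Levi-Civita connection is the matrix Gamma(u) with w |-> w Gamma(u); along
    the surface F the ambient connection pulls back to the operators cov i.
    Let f_1, f_2 be the coordinate fields of isothermal coordinates, with
    <f_i, f_j> = E delta_ij. Splitting Q(Z, Z) into real and imaginary parts,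
    holomorphy is the pair of equations obtained from

      d_i (Q_ii - Q_jj) + d_j (Q_ij + Q_ji) = 0

    for (i, j) = (1, 2) and (2, 1), and each of the three terms of Q is
    differentiated with four facts.

    Conformality gives cov_1 f_1 + cov_2 f_2 = 2 E H, so H is normal to the
    surface. As H is parallel in the normal bundle, cov_k H is tangent, equal to
    - E^-1 sum_l <cov_k f_l, H> f_l, and |H|^2 has zero derivative. Both xi and
    phi are parallel. Finally the commutator of cov_1 and cov_2 is the
    curvature, which gives the Codazzi equation: the combination above for
    <sigma, H> equals - 2 <R(f_i, f_j) f_j, H>, the terms with derivatives of E
    cancelling.

    The curvature of a cosymplectic space form then yields
    <R(f_i, f_j) f_j, H> = rho/4 (3 <f_i, phi f_j> <phi f_j, H>
                                  - E eta(f_i) eta(H)),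
    while the combinations for eta x eta and for <phi ., H>^2 are
    4 E eta(f_i) eta(H) and 4 |H|^2 <f_i, phi f_j> <phi f_j, H>. Weighted with
    8 |H|^2, - rho |H|^2 and 3 rho these cancel.

    The formula for the curvature is not part of the hypotheses, which only fix
    the phi-sectional curvature. It is deduced by polarization, as in the
    Kaehler case: the curvature commutes with phi and kills xi because phi is
    parallel, and a tensor with these symmetries is determined by its values
    on the planes spanned by u and phi u (kaehler_curvature_eq0).

    The analysis rests on two theorems proved first for real functions of
    several variables: continuous partial derivatives imply differentiability,
    and second derivatives commute. Everything smooth is reduced to these
    entry by entry. *)

Import Order.TTheory GRing.Theory Num.Theory numFieldNormedType.Exports.

(** * Differentiation of matrix-valued functions *)

Section MatrixCalculus.
Local Open Scope classical_set_scope.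
Local Open Scope ring_scope.
Variable R : realType.
Implicit Types V : normedModType R.

Lemma differentiable_entry V m n (M : V -> 'M[R]_(m, n)) x i j :
  differentiable M x -> differentiable (fun y => M y i j) x.
Proof.
by move=> dM; exact: (differentiable_comp dM (differentiable_coord _ i j)).
Qed.

Lemma differentiable_mx V m n (M : V -> 'M[R]_(m, n)) x :
  (forall i j, differentiable (fun y => M y i j) x) -> differentiable M x.
Proof.
move=> dM.
have -> : M = \sum_(i < m) \sum_(j < n) (fun y => M y i j *: delta_mx i j).
  apply/funext => y; rewrite [LHS]matrix_sum_delta fct_sumE.
  by apply: eq_bigr => i _; rewrite fct_sumE.
apply: differentiable_sum => i; apply: differentiable_sum => j.
exact: differentiableZl.
Qed.

Lemma derive_entry V m n (M : V -> 'M[R]_(m, n)) x v i j :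
  derivable M x v -> ('D_v M x : 'M[R]_(m, n)) i j = 'D_v (fun y => M y i j) x.
Proof. by move=> dM; rewrite derive_mx // mxE. Qed.

Lemma derivable_mulmx V m n p (A : V -> 'M[R]_(m, n)) (B : V -> 'M[R]_(n, p))
    x v : derivable A x v -> derivable B x v ->
  derivable (fun y => A y *m B y) x v /\
  'D_v (fun y => A y *m B y) x = 'D_v A x *m B x + A x *m 'D_v B x.
Proof.
move=> dA dB.
have dAe i j : derivable (fun y => A y i j) x v by move/derivable_mxP: dA.
have dBe i j : derivable (fun y => B y i j) x v by move/derivable_mxP: dB.
have E i j : (fun y => (A y *m B y) i j) =
    \sum_(k < n) ((fun y => A y i k) * (fun y => B y k j)).
  by apply/funext => y; rewrite mxE fct_sumE.
have dAB : derivable (fun y => A y *m B y) x v.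
  apply/derivable_mxP => i j; rewrite E; apply: derivable_sum => k.
  exact: derivableM.
split => //; apply/matrixP => i j.
rewrite derive_entry // E derive_sum; last by move=> k; exact: derivableM.
rewrite !mxE -big_split /=; apply: eq_bigr => k _.
rewrite (derive_entry _ _ dA) (derive_entry _ _ dB).
rewrite (deriveM (dAe _ _) (dBe _ _)) addrC.
by congr (_ + _); exact: mulrC.
Qed.

Lemma differentiable_mulmx V m n p (A : V -> 'M[R]_(m, n))
    (B : V -> 'M[R]_(n, p)) x :
  differentiable A x -> differentiable B x ->
  differentiable (fun y => A y *m B y) x.
Proof.
move=> dA dB; apply: differentiable_mx => i j.
have -> : (fun y => (A y *m B y) i j) =
    \sum_(k < n) ((fun y => A y i k) * (fun y => B y k j)).
  by apply/funext => y; rewrite mxE fct_sumE.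
by apply: differentiable_sum => k; apply: differentiableM;
  exact: differentiable_entry.
Qed.

Lemma derive_mulmx V m n p (A : V -> 'M[R]_(m, n)) (B : V -> 'M[R]_(n, p))
    x v : differentiable A x -> differentiable B x ->
  'D_v (fun y => A y *m B y) x = 'D_v A x *m B x + A x *m 'D_v B x.
Proof.
by move=> dA dB; apply: (derivable_mulmx _ _).2; exact: diff_derivable.
Qed.

Lemma differentiable_trmx V m n (A : V -> 'M[R]_(m, n)) x :
  differentiable A x -> differentiable (fun y => (A y)^T) x.
Proof.
move=> dA; apply: differentiable_mx => i j.
rewrite (_ : (fun y => _) = (fun y => A y j i)); first exact: differentiable_entry.
by apply/funext => y; rewrite mxE.
Qed.

Lemma derive_trmx V m n (A : V -> 'M[R]_(m, n)) x v :
  differentiable A x -> 'D_v (fun y => (A y)^T) x = ('D_v A x)^T.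
Proof.
move=> dA; apply/matrixP => i j; rewrite mxE !derive_entry; last 2 first.
- exact: diff_derivable.
- exact/diff_derivable/differentiable_trmx.
suff -> : (fun y => (A y)^T i j) = (fun y => A y j i) by [].
by apply/funext => y; rewrite mxE.
Qed.

Lemma differentiable_prod V (I : Type) (r : seq I) (f : I -> V -> R) x :
  (forall i, differentiable (f i) x) ->
  differentiable (fun y => \prod_(i <- r) f i y) x.
Proof.
move=> df; elim: r => [|i r IH].
  under eq_fun do rewrite big_nil; exact: differentiable_cst.
under eq_fun do rewrite big_cons.
exact: (differentiableM (df i) IH).
Qed.

Lemma differentiable_sumfun V (W : normedModType R) (I : Type) (r : seq I)
    (f : I -> V -> W) x :
  (forall i, differentiable (f i) x) ->
  differentiable (fun y => \sum_(i <- r) f i y) x.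
Proof.
move=> df; elim: r => [|i r IH].
  under eq_fun do rewrite big_nil; exact: differentiable_cst.
under eq_fun do rewrite big_cons.
exact: (differentiableD (df i) IH).
Qed.

Lemma differentiable_det V n (A : V -> 'M[R]_n) x :
  differentiable A x -> differentiable (fun y => \det (A y)) x.
Proof.
move=> dA; rewrite /determinant; apply: differentiable_sumfun => s.
apply: (@differentiableM _ _ (cst _)); first exact: differentiable_cst.
by apply: differentiable_prod => i; exact: differentiable_entry.
Qed.

Lemma near_eq_differentiable V (W : normedModType R) (f h : V -> W) x :
  (\forall y \near x, f y = h y) -> differentiable f x -> differentiable h x.
Proof.
move=> fh /[dup] df /diff_locallyP [dfc dfx].
have fhx : f x = h x by apply: (nbhs_singleton fh).
have hE : h \o shift x = cst (h x) + 'd f x +o_ 0 id.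
  apply/eqaddoP => e e0; have /eqaddoP/(_ e e0) := dfx.
  have : \forall k \near (0 : V), f (k + x) = h (k + x).
    by move: fh; rewrite (near_shift 0 x); apply: filterS => k /=; rewrite subr0.
  by apply: filterS2 => k /= fhk; rewrite -fhx /shift /= !fctE -fhk.
by apply/diff_locallyP; rewrite (diff_unique dfc hE).
Unshelve. all: by end_near. Qed.

Lemma differentiable_invmx V n (A : V -> 'M[R]_n) x :
  (\forall y \near x, A y \in unitmx) -> differentiable A x ->
  differentiable (fun y => invmx (A y)) x.
Proof.
move=> uA dA.
apply: (@near_eq_differentiable _ _ (fun y => (\det (A y))^-1 *: \adj (A y))).
  by near=> y; rewrite /invmx (near uA y).
have d0 : \det (A x) != 0.
  by move: (nbhs_singleton uA); rewrite unitmxE unitfE.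
apply: differentiable_mx => i j.
rewrite (_ : (fun y => _) =
  (fun y => (\det (A y))^-1) * (fun y => \adj (A y) i j)); last first.
  by apply/funext => y; rewrite mxE.
apply: differentiableM.
  by apply: differentiableV => //; exact: differentiable_det.
rewrite (_ : (fun y => _) = (fun y => cofactor (A y) j i)); last first.
  by apply/funext => y; rewrite mxE.
apply: (@differentiableM _ _ (cst _)); first exact: differentiable_cst.
apply: differentiable_det; apply: differentiable_mx => k l.
rewrite (_ : (fun y => _) = (fun y => A y (lift j k) (lift i l))); last first.
  by apply/funext => y; rewrite !mxE.
exact: differentiable_entry.
Unshelve. all: by end_near. Qed.
End MatrixCalculus.

(** * Partial derivatives of real functions of several variables *)

Section PartialDerivatives.
Local Open Scope classical_set_scope.
Local Open Scope ring_scope.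
Variable R : realType.

(** The difference quotients of f along v are those of a function of one real
    variable, which gives access to the mean value theorem. *)
Lemma derive_along_line (V W : normedModType R) (f : V -> W) a v s :
  ('D_1 (fun t : R => f (t *: v + a)) s = 'D_v f (s *: v + a)) *
  (derivable (fun t : R => f (t *: v + a)) s 1 = derivable f (s *: v + a) v).
Proof.
rewrite /derive /derivable.
suff -> : (fun h : R => h^-1 *: (f ((h *: 1 + s) *: v + a) - f (s *: v + a))) =
  (fun h : R => h^-1 *: (f (h *: v + (s *: v + a)) - f (s *: v + a))) by [].
by apply/funext => h; rewrite [h *: 1]mulr1 scalerDl addrA.
Qed.

Lemma line_mean_value (V : normedModType R) (f : V -> R) a v (t : R) :
  (forall s : R, `|s| <= `|t| -> derivable f (s *: v + a) v) ->
  exists2 s : R, `|s| <= `|t| &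
    f (t *: v + a) - f a = t * 'D_v f (s *: v + a).
Proof.
move=> df.
pose h (s : R) := f (s *: v + a).
pose dv (s : R) := 'D_v f (s *: v + a).
have dd (s : R) : `|s| <= `|t| -> derivable h s 1.
  by move=> st; rewrite (derive_along_line f a v s).2; exact: df.
have dh (s : R) : `|s| <= `|t| -> is_derive s 1 (h : R -> R) ('D_v f (s *: v + a)).
  by move=> st; rewrite -(derive_along_line f a v s).1; apply/derivableP/dd.
have ch (a' b' : R) : (forall s, s \in `[a', b']%R -> `|s| <= `|t|) ->
    {within `[a', b'], continuous h}.
  move=> ab; apply: derivable_within_continuous. move=> s /ab st.
  exact: dd.
have h0 : h 0 = f a by rewrite /h scale0r add0r.
case: (leP 0 t) => t0.
  have bnd s : s \in `[0, t]%R -> `|s| <= `|t|.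
    by rewrite in_itv /= => /andP[s0 st]; rewrite !ger0_norm.
  have [s|s /bnd sin E] := @MVT_segment R h dv 0 t t0 _ (ch _ _ bnd).
    by move/subset_itv_oo_cc/bnd/dh; exact.
  by exists s => //; rewrite -h0 -[f (_ + a)]/(h t) E subr0 mulrC.
have bnd s : s \in `[t, 0]%R -> `|s| <= `|t|.
  rewrite in_itv /= => /andP[s0 st]; rewrite !ler0_norm //; last exact: ltW.
  by rewrite lerN2.
have [s|s /bnd sin E] := @MVT_segment R h dv t 0 (ltW t0) _ (ch _ _ bnd).
  by move/subset_itv_oo_cc/bnd/dh; exact.
exists s => //; rewrite -h0 -[f (_ + a)]/(h t).
by rewrite -[LHS]opprB E sub0r mulrN opprK mulrC.
Qed.

Lemma entry_le_norm m n (M : 'M[R]_(m, n)) i j : `|M i j| <= `|M|.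
Proof.
rewrite [leRHS]/Num.Def.normr /= mx_normrE.
exact: (le_bigmax _ (fun ij => `|M ij.1 ij.2|) (i, j)).
Qed.

Lemma norm_le_entries m n (M : 'M[R]_(m, n)) e : 0 <= e ->
  (forall i j, `|M i j| <= e) -> `|M| <= e.
Proof.
move=> e0 Me; rewrite [leLHS]/Num.Def.normr /= mx_normrE.
by apply: bigmax_le => // -[i j] _ /=; exact: Me.
Qed.

(** An increment h is split into steps along the coordinate axes; each step is
    a partial derivative at an intermediate point, close to the one at x by
    continuity. *)
Lemma differentiable_of_partials k (f : 'rV[R]_k -> R) x :
  (forall i, \forall y \near x, derivable f y (ebasis R i)) ->
  (forall i, {for x, continuous (fun y => 'D_(ebasis R i) f y)}) ->
  differentiable f x.
Proof.
move=> pf cf.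
pose c := \col_i 'D_(ebasis R i) f x.
pose L (h : 'rV[R]_k) : R := (h *m c) 0 0.
have L_lin : linear L by move=> a u v; rewrite /L mulmxDl -scalemxAl !mxE.
pose Lm := GRing.isLinear.Build _ _ _ _ _ L_lin.
pose LL : {linear 'rV[R]_k -> R} := HB.pack L Lm.
have LLE : (LL : _ -> _) = L by [].
have Lc : continuous LL.
  move=> h; rewrite LLE /L; apply: differentiable_continuous.
  apply: differentiable_entry; apply: differentiable_mulmx => //.
suff LE : f \o shift x = cst (f x) + LL +o_ 0 id.
  by apply/diff_locallyP; rewrite (diff_unique Lc LE).
apply/eqaddoP => e e0.
have k1 : 0 < (k.+1)%:R :> R by rewrite ltr0n.
(* k.+1 instead of k, so that the bound also makes sense for k = 0 *)
have ek : 0 < e / (k.+1)%:R by rewrite divr_gt0.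
pose P i : set 'rV[R]_k := [set y | derivable f y (ebasis R i) /\
  `|'D_(ebasis R i) f x - 'D_(ebasis R i) f y| <= e / (k.+1)%:R].
have good : \forall y \near x, forall i, P i y.
  apply: (@filter_forall _ _ P (nbhs x) (nbhs_filter x)) => i.
  have /cvgrPdist_le/(_ _ ek) := cf i.
  by move: (pf i); apply: filterS2.
have /nbhs_ballP[d /= d0 dgood] := good.
apply/nbhs_ballP; exists d => //= h.
rewrite -ball_normE /ball_ /= sub0r normrN => hd.
(* the path from 0 to h along the coordinate axes *)
pose p (i : nat) : 'rV[R]_k := \row_j (if (j < i)%N then h 0 j else 0).
have p0 : p 0%N = 0 by apply/rowP => j; rewrite !mxE.
have pk : p k = h by apply/rowP => j; rewrite !mxE ltn_ord.
have pS (i : 'I_k) : p i.+1 = h 0 i *: ebasis R i + p i.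
  apply/rowP => j; rewrite !mxE /= ltnS leq_eqVlt (inj_eq val_inj).
  have [->|ji] := eqVneq j i; first by rewrite ltnn mulr1 addr0.
  by rewrite mulr0 add0r.
have step (i : 'I_k) :
    `|f (p i.+1 + x) - f (p i + x) - h 0 i * c i 0| <= e / (k.+1)%:R * `|h|.
  have hb s : `|s| <= `|h 0 i| -> ball x d (s *: ebasis R i + (p i + x)).
    move=> sh; rewrite -ball_normE /ball_ /= addrA opprD addrCA subrr addr0 normrN.
    apply: le_lt_trans hd; apply: norm_le_entries => // a j.
    rewrite !ord1 !mxE eqxx /=.
    have [->|ji] := eqVneq j i.
      by rewrite ltnn mulr1 addr0 (le_trans sh) // entry_le_norm.
    rewrite mulr0 add0r; case: ifP => _; last by rewrite normr0.
    exact: entry_le_norm.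
  have [s sh|s sh E] := @line_mean_value _ f (p i + x) (ebasis R i) (h 0 i).
    by have [] := dgood _ (hb _ sh) i.
  rewrite pS -[_ + p i + x]addrA E -mulrBr mxE normrM mulrC ler_pM //.
    by rewrite distrC; have [] := dgood _ (hb _ sh) i.
  exact: entry_le_norm.
have tele : f (h + x) - f x = \sum_(i < k) (f (p i.+1 + x) - f (p i + x)).
  rewrite -(big_mkord xpredT (fun i => f (p i.+1 + x) - f (p i + x))).
  by rewrite telescope_sumr // p0 pk add0r.
rewrite (_ : (_ - _) h = f (h + x) - (f x + (h *m c) 0 0)) // mxE opprD addrA tele -sumrB.
apply: le_trans (ler_norm_sum _ _ _) _.
apply: (@le_trans _ _ (\sum_(i < k) e / (k.+1)%:R * `|h|)).
  by apply: ler_sum => i _; exact: step.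
rewrite sumr_const card_ord -[_ *+ k]mulr_natl mulrA ler_wpM2r //.
rewrite mulrCA ger_pMr // ler_pdivrMr // mul1r ler_nat; exact: leqnSn.
Qed.

Lemma derive_translate (V W : normedModType R) (f : V -> W) a v y :
  ('D_v (fun z => f (a + z)) y = 'D_v f (a + y)) *
  (derivable (fun z => f (a + z)) y v = derivable f (a + y) v).
Proof.
rewrite /derive /derivable.
suff -> : (fun h : R => h^-1 *: (f (a + (h *: v + y)) - f (a + y))) =
  (fun h : R => h^-1 *: (f (h *: v + (a + y)) - f (a + y))) by [].
by apply/funext => h; rewrite addrCA.
Qed.

(** Two applications of the mean value theorem, the first to
    y |-> f (t v + y) - f y along u. The left-hand side is symmetric in u and v,
    which is what makes second derivatives commute. *)
Lemma second_difference (V : normedModType R) (f : V -> R) (u v x : V) (t : R) :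
  (forall r s : R, `|r| <= `|t| -> `|s| <= `|t| ->
     derivable f (r *: v + (s *: u + x)) u /\
     derivable ('D_u f) (r *: v + (s *: u + x)) v) ->
  exists r s : R, [/\ `|r| <= `|t|, `|s| <= `|t| &
    f (t *: v + (t *: u + x)) - f (t *: u + x) - (f (t *: v + x) - f x) =
    t * (t * 'D_v ('D_u f) (r *: v + (s *: u + x)))].
Proof.
move=> df.
have d0 s : `|s| <= `|t| -> derivable f (s *: u + x) u.
  have n0 : `|0 : R| <= `|t| by rewrite normr0.
  by move=> st; have := (df 0 s n0 st).1; rewrite scale0r add0r; apply.
have dt s : `|s| <= `|t| -> derivable (fun y => f (t *: v + y)) (s *: u + x) u.
  by move=> st; rewrite (derive_translate f _ _ _).2; apply: (df t s _ st).1.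
pose g y := f (t *: v + y) - f y.
have [s|s st E] := @line_mean_value _ g x u t.
  by move=> st; apply: derivableB; [exact: dt|exact: d0].
have [r|r rt E'] := @line_mean_value _ ('D_u f) (s *: u + x) v t.
  by move=> rt; exact: (df r s rt st).2.
exists r, s; split=> //; rewrite -E' [LHS]E; congr (_ * _).
by rewrite deriveB; [rewrite derive_translate|exact: dt|exact: d0].
Qed.

Lemma close_to_common (a b p e : R) :
  `|a - p| <= e / 2 -> `|b - p| <= e / 2 -> `|a - b| <= e.
Proof. by rewrite !ler_norml => /andP[? ?] /andP[? ?]; apply/andP; split; lra. Qed.

(** The second difference quotient with step t is a value of either mixed
    derivative near x; both values tend to the values at x. *)
Lemma derive_comm (V : normedModType R) (f : V -> R) (u v x : V) :
  (\forall y \near x, [/\ derivable f y u, derivable f y v,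
      derivable ('D_u f) y v & derivable ('D_v f) y u]) ->
  {for x, continuous ('D_v ('D_u f))} -> {for x, continuous ('D_u ('D_v f))} ->
  'D_v ('D_u f) x = 'D_u ('D_v f) x.
Proof.
move=> df cvu cuv.
apply/eqP; rewrite -subr_eq0 -normr_le0; apply/ler_addgt0Pl => e e0.
rewrite addr0.
have e2 : 0 < e / 2 by rewrite divr_gt0.
move/cvgrPdist_le/(_ _ e2) : cvu => cvu.
move/cvgrPdist_le/(_ _ e2) : cuv => cuv.
have [d /= d0 dP] := (nbhs_ballP _ _).1 (filterI df (filterI cvu cuv)).
have c0 : 0 < `|u| + `|v| + 1 by rewrite ltr_wpDl // addr_ge0.
(* with this step all the points x + r u + s v, |r|, |s| <= t, lie in the ball *)
pose t := d / (`|u| + `|v| + 1).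
have t0 : 0 < t by rewrite divr_gt0.
have near_x (a b : V) (r s : R) : `|a| + `|b| = `|u| + `|v| ->
    `|r| <= `|t| -> `|s| <= `|t| -> ball x d (r *: a + (s *: b + x)).
  move=> ab rt st; rewrite -ball_normE /ball_ /= addrA opprD addrCA subrr addr0.
  rewrite normrN; apply: le_lt_trans (ler_normD _ _) _; rewrite !normrZ.
  apply: (@le_lt_trans _ _ (t * (`|u| + `|v|))).
    rewrite -ab mulrDr; rewrite (ger0_norm (ltW t0)) in rt st.
    by apply: lerD; apply: ler_wpM2r.
  by rewrite /t -mulrA gtr_pMr // ltr_pdivrMl // mulr1 ltrDl.
have [r s rt st|r [s [rt st E]]] := @second_difference _ f u v x t.
  by have [[]] := dP _ (near_x v u r s (addrC _ _) rt st).
have [r' s' rt' st'|r' [s' [rt' st' E']]] := @second_difference _ f v u x t.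
  by have [[]] := dP _ (near_x u v r' s' erefl rt' st').
have tt0 : t * t != 0 :> R by rewrite mulf_neq0 // gt_eqF.
have EE : 'D_v ('D_u f) (r *: v + (s *: u + x)) =
          'D_u ('D_v f) (r' *: u + (s' *: v + x)) :> R.
  have C : f (t *: v + (t *: u + x)) = f (t *: u + (t *: v + x)).
    by rewrite addrCA.
  move: E E'; rewrite C; set p := f (_ + (_ + _)); set q := f (_ + _).
  set q' := f (_ + _); set a := 'D_v _ _; set b := 'D_u _ _ => E E'.
  apply: (mulfI tt0); transitivity (p - q - (q' - f x)).
    by rewrite E mulrA.
  by rewrite -mulrA -E'; ring.
have [_ [/= A _]] := dP _ (near_x v u r s (addrC _ _) rt st).
have [_ [/= _ B]] := dP _ (near_x u v r' s' erefl rt' st').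
rewrite EE in A; exact: close_to_common A B.
Qed.

End PartialDerivatives.

(** * Smooth matrix-valued maps *)

Section SmoothMaps.
Local Open Scope classical_set_scope.
Local Open Scope ring_scope.
Variables (R : realType) (k : nat).
Implicit Types (U : set 'rV[R]_k) (W : normedModType R).

Lemma near_of_open (T : topologicalType) (A : set T) (x : T) :
  open A -> A x -> \forall y \near x, A y.
Proof. by move=> oA Ax; apply: open_nbhs_nbhs; split. Qed.

Lemma derive_linear (V W : normedModType R) (f : V -> W) x a u v :
  differentiable f x ->
  'D_(a *: u + v) f x = a *: 'D_u f x + 'D_v f x.
Proof. by move=> df; rewrite !deriveE // linearP. Qed.

Lemma row_sum_ebasis (v : 'rV[R]_k) : v = \sum_i v 0 i *: ebasis R i.
Proof. exact: row_sum_delta. Qed.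

Lemma derive_sum_ebasis W (f : 'rV[R]_k -> W) x (v : 'rV[R]_k) : differentiable f x ->
  'D_v f x = \sum_i v 0 i *: 'D_(ebasis R i) f x.
Proof.
move=> df; rewrite {1}(row_sum_ebasis v) deriveE // linear_sum.
by apply: eq_bigr => i _; rewrite linearZ /= deriveE.
Qed.

(** Ck_on mentions the derivatives of f only at points of U, but these depend
    on the germ of f; this is where openness of U enters. *)
Lemma Ck_on_eq W r U (f h : 'rV[R]_k -> W) : open U ->
  (forall x, U x -> f x = h x) -> Ck_on r U f -> Ck_on r U h.
Proof.
move=> oU; elim: r f h => [|r IH] f h fh /=.
  move=> cf x Ux; have fhx := near_of_open oU Ux.
  have nfh : \forall y \near x, f y = h y by apply: filterS fhx.
  rewrite /prop_for /continuous_at -(fh _ Ux).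
  exact: cvg_trans (near_eq_cvg nfh) (cf _ Ux).
have nfh x : U x -> \forall y \near x, f y = h y.
  by move=> Ux; apply: filterS (near_of_open oU Ux).
move=> [cf df]; split.
  move=> x Ux; rewrite /prop_for /continuous_at -(fh _ Ux).
  exact: cvg_trans (near_eq_cvg (nfh _ Ux)) (cf _ Ux).
move=> i; have [dfi Cfi] := df i; split.
  by move=> x Ux; exact: near_eq_derivable (nfh x Ux) (dfi x Ux).
apply: IH Cfi => x Ux; exact: near_eq_derive (nfh x Ux).
Qed.

Lemma Ck_on_entry p q r U (M : 'rV[R]_k -> 'M[R]_(p, q)) i j : open U ->
  Ck_on r U M -> Ck_on r U (fun x => M x i j).
Proof.
move=> oU; elim: r M => [|r IH] M /=.
  move=> cM x Ux.
  exact: (continuous_comp (cM x Ux) (@coord_continuous _ _ _ _ _ _)).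
move=> [cM dM]; split.
  move=> x Ux.
  exact: (continuous_comp (cM x Ux) (@coord_continuous _ _ _ _ _ _)).
move=> l; have [dMl CMl] := dM l; split.
  by move=> x Ux; have /derivable_mxP := dMl x Ux; apply.
apply: Ck_on_eq (IH _ CMl) => // x Ux.
by rewrite derive_entry //; exact: dMl.
Qed.

Lemma smooth_on_partial W U (f : 'rV[R]_k -> W) i :
  smooth_on U f -> smooth_on U ('D_(ebasis R i) f).
Proof. by move=> sf r; have [_ /(_ i) []] := sf r.+1. Qed.

Lemma smooth_differentiable p q U (M : 'rV[R]_k -> 'M[R]_(p, q)) x :
  open U -> smooth_on U M -> U x -> differentiable M x.
Proof.
move=> oU sM Ux; apply: differentiable_mx => i j.
have [/= _ C1] := Ck_on_entry i j oU (sM 1%N).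
apply: differentiable_of_partials => l.
  by apply: filterS (near_of_open oU Ux) => y Uy; exact: (C1 l).1 y Uy.
exact: (C1 l).2 x Ux.
Qed.

Lemma smooth_cst W U (c : W) : smooth_on U (fun=> c).
Proof.
have C r (d : W) : Ck_on r U (fun=> d).
  elim: r d => [|r IH] d /=; first by move=> x _; apply: cst_continuous.
  split; first by move=> x _; apply: cst_continuous.
  move=> i; split; first by move=> x _; exact: derivable_cst.
  have -> : (fun x => 'D_(ebasis R i) (fun=> d) x) = (fun=> 0).
    by apply/funext => x; exact: derive_cst.
  exact: IH.
by move=> r; exact: C.
Qed.

Section AtPoint.
Variables (p q : nat) (U : set 'rV[R]_k) (M : 'rV[R]_k -> 'M[R]_(p, q)).
Hypotheses (oU : open U) (sM : smooth_on U M).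
Variables (x : 'rV[R]_k) (Ux : U x).

(** A derivative in an arbitrary constant direction is a combination of partial
    derivatives near x, so it inherits their regularity. *)
Lemma smooth_near_derive (v : 'rV[R]_k) :
  \forall y \near x, \sum_i v 0 i *: 'D_(ebasis R i) M y = 'D_v M y.
Proof.
apply: filterS (near_of_open oU Ux) => y Uy.
by rewrite (derive_sum_ebasis v (smooth_differentiable oU sM Uy)).
Qed.

Lemma smooth_differentiable_derive (v : 'rV[R]_k) : differentiable ('D_v M) x.
Proof.
apply: near_eq_differentiable (smooth_near_derive v) _.
apply: differentiable_sumfun => i; apply: differentiableZ.
exact: smooth_differentiable oU (smooth_on_partial i sM) Ux.
Qed.

Lemma smooth_partial_comm i j :
  'D_(ebasis R i) ('D_(ebasis R j) M) x = 'D_(ebasis R j) ('D_(ebasis R i) M) x.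
Proof.
apply/matrixP => a b.
have [/= _ C2] := Ck_on_entry a b oU (sM 2).
have dM l y : U y -> derivable M y (ebasis R l).
  by move=> Uy; apply/diff_derivable/(smooth_differentiable oU sM).
have dDM l y v : U y -> derivable ('D_(ebasis R l) M) y v.
  move=> Uy; apply/diff_derivable.
  exact: smooth_differentiable oU (smooth_on_partial l sM) Uy.
refine (etrans (derive_entry a b (dDM j x (ebasis R i) Ux)) _).
refine (etrans _ (esym (derive_entry a b (dDM i x (ebasis R j) Ux)))).
have E l l' : 'D_(ebasis R l) (fun y => ('D_(ebasis R l') M y : 'M[R]_(p, q)) a b) x =
    'D_(ebasis R l) ('D_(ebasis R l') (fun y => M y a b)) x.
  apply: near_eq_derive; apply: filterS (near_of_open oU Ux) => y Uy.
  exact: derive_entry a b (dM l' y Uy).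
refine (etrans (E i j) (etrans _ (esym (E j i)))); apply: derive_comm.
- apply: filterS (near_of_open oU Ux) => y Uy.
  have [A [_ /(_ i) [A' _]]] := C2 j; have [B [_ /(_ j) [B' _]]] := C2 i.
  by split; [exact: A|exact: B|exact: A'|exact: B'].
- by have [_ [_ /(_ i) [_]]] := C2 j; apply.
- by have [_ [_ /(_ j) [_]]] := C2 i; apply.
Qed.

Lemma smooth_derive2 (u v : 'rV[R]_k) : 'D_u ('D_v M) x =
  \sum_i \sum_j (v 0 i * u 0 j) *: 'D_(ebasis R j) ('D_(ebasis R i) M) x.
Proof.
rewrite -(near_eq_derive _ (smooth_near_derive v)).
have dD i : differentiable ('D_(ebasis R i) M) x.
  exact: smooth_differentiable oU (smooth_on_partial i sM) Ux.
have -> : (fun y => \sum_i v 0 i *: 'D_(ebasis R i) M y) =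
    \sum_i (v 0 i *: 'D_(ebasis R i) M).
  by apply/funext => y; rewrite fct_sumE.
rewrite derive_sum; last by move=> i; exact/diff_derivable/differentiableZ.
apply: eq_bigr => i _; rewrite deriveZ; last exact: diff_derivable.
rewrite (derive_sum_ebasis u (dD i)) scaler_sumr.
by apply: eq_bigr => j _; rewrite scalerA.
Qed.

Lemma smooth_derive_comm (u v : 'rV[R]_k) : 'D_u ('D_v M) x = 'D_v ('D_u M) x.
Proof.
rewrite !smooth_derive2 exchange_big /=; apply: eq_bigr => i _.
by apply: eq_bigr => j _; rewrite smooth_partial_comm mulrC.
Qed.

End AtPoint.
End SmoothMaps.

(** * Algebraic curvature tensors *)

Section CurvatureAlgebra.
Local Open Scope ring_scope.
Variables (R : realFieldType) (V : lmodType R).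

Definition curvature_like (K : V -> V -> V -> V -> R) : Prop :=
  [/\ forall x y z w, K x y z w = - K y x z w,
      forall x y z w, K x y z w = - K x y w z &
      forall x y z w, K x y z w + K y z x w + K z x y w = 0].

Definition linear_in_first (K : V -> V -> V -> V -> R) : Prop :=
  forall a x x' y z w, K (a *: x + x') y z w = a * K x y z w + K x' y z w.

(** A signed sum of the four cyclic identities obtained by rotating
    x, y, z, w. *)
Lemma curvature_like_pair_sym K : curvature_like K ->
  forall x y z w, K x y z w = K z w x y.
Proof.
move=> [s12 s34 B] x y z w.
move: (B x y z w) (B y z w x) (B z w x y) (B w x y z).
move: (s12 z x y w) (s34 y z w x) (s34 z w y x) (s12 w y z x) (s34 y w z x).
move: (s12 w x z y) (s34 x w z y) (s34 x z w y) (s12 w x y z) (s34 x y w z).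
lra.
Qed.

Lemma additive_opp (h : V -> R) :
  (forall a b, h (a + b) = h a + h b) -> forall a, h (- a) = - h a.
Proof.
move=> hD a; have h0 : h 0 = 0 by have := hD 0 0; rewrite addr0; lra.
by have := hD a (- a); rewrite addrN h0; lra.
Qed.

Section Multilinear.
Variable K : V -> V -> V -> V -> R.
Hypotheses (cK : curvature_like K) (lK : linear_in_first K).

Let s12 x y z w : K x y z w = - K y x z w. Proof. by case: cK. Qed.
Let s34 x y z w : K x y z w = - K x y w z. Proof. by case: cK. Qed.
Let B x y z w : K x y z w + K y z x w + K z x y w = 0. Proof. by case: cK. Qed.
Let pair x y z w : K x y z w = K z w x y.
Proof. exact: curvature_like_pair_sym cK x y z w. Qed.

Lemma curvature_like_linear2 a x y y' z w :
  K x (a *: y + y') z w = a * K x y z w + K x y' z w.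
Proof. by rewrite s12 lK (s12 y) (s12 y'); ring. Qed.

Lemma curvature_like_linear3 a x y z z' w :
  K x y (a *: z + z') w = a * K x y z w + K x y z' w.
Proof. by rewrite pair lK -!(pair x y). Qed.

Lemma curvature_like_linear4 a x y z w w' :
  K x y z (a *: w + w') = a * K x y z w + K x y z w'.
Proof. by rewrite s34 curvature_like_linear3 (s34 x y w) (s34 x y w'); ring. Qed.

Let D1 x x' y z w : K (x + x') y z w = K x y z w + K x' y z w.
Proof. by rewrite -{1}[x]scale1r lK mul1r. Qed.
Let D2 x y y' z w : K x (y + y') z w = K x y z w + K x y' z w.
Proof. by rewrite -{1}[y]scale1r curvature_like_linear2 mul1r. Qed.
Let D3 x y z z' w : K x y (z + z') w = K x y z w + K x y z' w.
Proof. by rewrite -{1}[z]scale1r curvature_like_linear3 mul1r. Qed.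
Let D4 x y z w w' : K x y z (w + w') = K x y z w + K x y z w'.
Proof. by rewrite -{1}[w]scale1r curvature_like_linear4 mul1r. Qed.

Let N1 x y z w : K (- x) y z w = - K x y z w.
Proof. by rewrite (additive_opp (fun a b => D1 a b y z w)). Qed.
Let N2 x y z w : K x (- y) z w = - K x y z w.
Proof. by rewrite (additive_opp (fun a b => D2 x a b z w)). Qed.
Let N3 x y z w : K x y (- z) w = - K x y z w.
Proof. by rewrite (additive_opp (fun a b => D3 x y a b w)). Qed.
Let N4 x y z w : K x y z (- w) = - K x y z w.
Proof. by rewrite (additive_opp (fun a b => D4 x y z a b)). Qed.

(** Polarizing twice, K is skew under the exchange of its first and third
    arguments as well; the three terms of the cyclic identity are then equal. *)
Lemma curvature_like_eq0 :
  (forall x y, K x y x y = 0) -> forall x y z w, K x y z w = 0.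
Proof.
move=> K0.
have K1 x y w : K x y x w = 0.
  have := K0 x (y + w); rewrite D2 !D4 !K0 (pair x w); lra.
have K2 x y z w : K x y z w = - K z y x w.
  by have := K1 (x + z) y w; rewrite D1 !D3 !K1; lra.
move=> x y z w; move: (B x y z w) (K2 y z x w) (s12 x z y w).
move: (K2 z x y w) (s12 y x z w).
lra.
Qed.

Variables (phi : V -> V) (xi : V) (eta : V -> R).
Hypothesis phiD : forall x y, phi (x + y) = phi x + phi y.
Hypothesis phiN : forall x, phi (- x) = - phi x.
Hypothesis phi2 : forall x, phi (phi x) = - x + eta x *: xi.
Hypothesis Kphi : forall x y z w, K x y (phi z) (phi w) = K x y z w.
Hypothesis Kxi : forall x y z, K x y z xi = 0.
Hypothesis Khol : forall x, K x (phi x) x (phi x) = 0.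

Let Kphi12 x y z w : K (phi x) (phi y) z w = K x y z w.
Proof. by rewrite pair Kphi pair. Qed.
Let K4phi2 x y z w : K x y z (phi (phi w)) = - K x y z w.
Proof.
have K40 : K x y z 0 = 0 by rewrite -(subrr xi) D4 N4 subrr.
by rewrite phi2 D4 N4 -[eta w *: xi]addr0 curvature_like_linear4 Kxi K40; ring.
Qed.
Let K2phi2 x y z w : K x (phi (phi y)) z w = - K x y z w.
Proof. by rewrite pair K4phi2 pair. Qed.

Let slot_phi x y z w : K y (phi x) z w = K x (phi y) z w.
Proof. by rewrite -Kphi12 K2phi2 s12 opprK. Qed.

(** The vanishing of K x (phi x) x (phi x), polarized at x + y and x - y, says
    2 K x (phi x) y (phi y) + 4 K x (phi y) x (phi y) = 0. With the cyclic
    identity it becomes K x y x y + 3 K x (phi y) x (phi y) = 0, and replacing y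
    by phi y exchanges the two terms, so both are zero. *)
Lemma kaehler_curvature_eq0 : forall x y z w, K x y z w = 0.
Proof.
have polar x y : 2 * K x (phi x) y (phi y) + 4 * K x (phi y) x (phi y) = 0.
  have := Khol (x + y); have := Khol (x - y).
  rewrite !phiD !phiN !(D1, D2, D3, D4).
  rewrite !(N1, N2, N3, N4) !Khol !(slot_phi x y).
  rewrite (pair y (phi y)) (pair x (phi y) y) (slot_phi x y); lra.
apply: curvature_like_eq0 => x y.
have key x' y' : K x' y' x' y' + 3 * K x' (phi y') x' (phi y') = 0.
  move: (polar x' y') (B x' (phi x') y' (phi y')).
  rewrite (s12 (phi x') y') (slot_phi x' y') Kphi (s12 y' x'); lra.
by have := key x y; have := key x (phi y); rewrite K2phi2 K4phi2; lra.
Qed.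

End Multilinear.
End CurvatureAlgebra.

(** * The curvature tensor of a cosymplectic space form *)

Section SpaceFormTensor.
Local Open Scope ring_scope.
Variables (R : rcfType) (V : lmodType R).
Variables (ip : V -> V -> R) (phi : V -> V) (xi : V).

(** An almost contact metric structure on a single tangent space. *)
Record contact_algebra : Prop := ContactAlgebra {
  ca_sym : forall x y, ip x y = ip y x;
  ca_lin : forall a x y z, ip (a *: x + y) z = a * ip x z + ip y z;
  ca_pos : forall x, x != 0 -> 0 < ip x x;
  ca_xi : ip xi xi = 1;
  ca_phi_lin : forall a x y, phi (a *: x + y) = a *: phi x + phi y;
  ca_phi2 : forall x, phi (phi x) = - x + ip x xi *: xi;
  ca_phi_ip : forall x y, ip (phi x) (phi y) = ip x y - ip x xi * ip y xi
}.

Hypothesis ca : contact_algebra.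
Local Notation eta x := (ip x xi).

Lemma ipC x y : ip x y = ip y x. Proof. exact: ca_sym ca x y. Qed.
Lemma ipDl x y z : ip (x + y) z = ip x z + ip y z.
Proof. by rewrite -{1}[x]scale1r (ca_lin ca) mul1r. Qed.
Lemma ip0l z : ip 0 z = 0.
Proof. by have := ipDl 0 0 z; rewrite addr0; lra. Qed.
Lemma ipZl a x z : ip (a *: x) z = a * ip x z.
Proof. by rewrite -{1}[a *: x]addr0 (ca_lin ca) ip0l addr0. Qed.
Lemma ipNl x z : ip (- x) z = - ip x z.
Proof. by rewrite -scaleN1r ipZl mulN1r. Qed.
Lemma ipDr x y z : ip z (x + y) = ip z x + ip z y.
Proof. by rewrite !(ipC z) ipDl. Qed.
Lemma ipZr a x z : ip z (a *: x) = a * ip z x.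
Proof. by rewrite !(ipC z) ipZl. Qed.
Lemma ipNr x z : ip z (- x) = - ip z x.
Proof. by rewrite !(ipC z) ipNl. Qed.

Lemma ip_eq0 x : ip x x = 0 -> x = 0.
Proof.
move=> x0; apply/eqP; apply: contraT => /(ca_pos ca).
by rewrite x0 ltxx.
Qed.

Lemma phiD x y : phi (x + y) = phi x + phi y.
Proof. by rewrite -{1}[x]scale1r (ca_phi_lin ca) scale1r. Qed.
Lemma phi0 : phi 0 = 0.
Proof. by apply: (addrI (phi 0)); rewrite -phiD !addr0. Qed.
Lemma phiZ a x : phi (a *: x) = a *: phi x.
Proof. by rewrite -{1}[a *: x]addr0 (ca_phi_lin ca) phi0 addr0. Qed.
Lemma phiN x : phi (- x) = - phi x.
Proof. by rewrite -scaleN1r phiZ scaleN1r. Qed.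

Lemma phi_xi : phi xi = 0.
Proof. by apply: ip_eq0; rewrite (ca_phi_ip ca) (ca_xi ca) mulr1 subrr. Qed.

(** The two ways to compute phi^3 x differ by eta(phi x) xi. *)
Lemma eta_phi x : eta (phi x) = 0.
Proof.
have := ca_phi2 ca (phi x); rewrite (ca_phi2 ca x) phiD phiN phiZ phi_xi.
rewrite scaler0 addr0 => /esym/eqP; rewrite -subr_eq0 opprK addrAC addNr add0r.
move=> /eqP /(congr1 (fun v => ip v xi)).
by rewrite ipZl (ca_xi ca) mulr1 ip0l.
Qed.

Lemma phi_skew x y : ip (phi x) y = - ip x (phi y).
Proof.
have := ca_phi_ip ca x (phi y); rewrite (ca_phi2 ca) ipDr ipNr ipZr !eta_phi.
by rewrite !mulr0 subr0; lra.
Qed.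

Lemma ip_phi_self x : ip x (phi x) = 0.
Proof. by have := phi_skew x x; rewrite ipC; lra. Qed.

(** Multiplied by rho / 4, this is <R(x, y) z, w>. *)
Definition space_form_tensor (x y z w : V) : R :=
  ip y z * ip x w - ip x z * ip y w
  + ip x (phi z) * ip (phi y) w - ip y (phi z) * ip (phi x) w
  + 2 * ip x (phi y) * ip (phi z) w
  + eta x * eta z * ip y w - eta y * eta z * ip x w
  + ip x z * eta y * eta w - ip y z * eta x * eta w.

Lemma space_form_tensor_curvature_like : curvature_like space_form_tensor.
Proof.
have sk x y : ip y (phi x) = - ip x (phi y) by rewrite -phi_skew ipC.
split; rewrite /space_form_tensor => x y z w; rewrite !phi_skew.
- by rewrite (sk x y); ring.
- by rewrite (sk z w) (sk z y) (sk z x); ring.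
- by rewrite (sk x y) (sk z y) (sk x z) (ipC z y) (ipC y x) (ipC z x); ring.
Qed.

Lemma space_form_tensor_linear : linear_in_first space_form_tensor.
Proof.
move=> a x x' y z w; rewrite /space_form_tensor phiD phiZ !(ipDl, ipZl); ring.
Qed.

Lemma space_form_tensor_phi x y z w :
  space_form_tensor x y (phi z) (phi w) = space_form_tensor x y z w.
Proof.
rewrite /space_form_tensor !(ca_phi_ip ca) !eta_phi !(ca_phi2 ca).
by rewrite !(ipDr, ipNr, ipZr) !phi_skew; ring.
Qed.

Lemma space_form_tensor_xi x y z : space_form_tensor x y z xi = 0.
Proof. by rewrite /space_form_tensor !eta_phi (ca_xi ca); ring. Qed.

Lemma space_form_tensor_hol x :
  space_form_tensor x (phi x) x (phi x) = - 4 * ip (phi x) (phi x) ^+ 2.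
Proof.
rewrite /space_form_tensor !(ca_phi2 ca) !eta_phi !(ca_phi_ip ca).
rewrite !(ipDr, ipDl, ipNr, ipNl, ipZr, ipZl) (ipC (phi x)) !ip_phi_self (ipC xi).
ring.
Qed.

Variables (K : V -> V -> V -> V -> R) (rho : R).
Hypotheses (cK : curvature_like K) (lK : linear_in_first K).
Hypothesis Kphi : forall x y z w, K x y (phi z) (phi w) = K x y z w.
Hypothesis Kxi : forall x y z, K x y z xi = 0.
Hypothesis Khol : forall u, ip u u = 1 -> eta u = 0 ->
  K u (phi u) (phi u) u = rho.

Let Kscale a x y z w :
  (K (a *: x) y z w = a * K x y z w) * (K x (a *: y) z w = a * K x y z w) *
  (K x y (a *: z) w = a * K x y z w) * (K x y z (a *: w) = a * K x y z w).
Proof.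
have K0 : (K 0 y z w = 0) * (K x 0 z w = 0) * (K x y 0 w = 0) * (K x y z 0 = 0).
  have := lK 1 0 0 y z w; have := curvature_like_linear2 cK lK 1 x 0 0 z w.
  have := curvature_like_linear3 cK lK 1 x y 0 0 w.
  have := curvature_like_linear4 cK lK 1 x y z 0 0.
  by rewrite !scaler0 !addr0 => ? ? ? ?; do !split; lra.
have := lK a x 0 y z w; have := curvature_like_linear2 cK lK a x y 0 z w.
have := curvature_like_linear3 cK lK a x y z 0 w.
have := curvature_like_linear4 cK lK a x y z w 0.
by rewrite !addr0 !K0 !addr0 => -> -> -> ->.
Qed.

Let Khol_scaled x : K x (phi x) x (phi x) = - rho * ip (phi x) (phi x) ^+ 2.
Proof.
have [s12 s34 _] := cK.
(* K does not see the component of x along xi, so x may be projected away from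
   it and then normalized *)
pose u := x - eta x *: xi.
have phiu : phi u = phi x by rewrite /u phiD phiN phiZ phi_xi scaler0 oppr0 addr0.
have etau : eta u = 0 by rewrite /u ipDl ipNl ipZl (ca_xi ca) mulr1 subrr.
have Ku : K x (phi x) x (phi x) = K u (phi u) u (phi u).
  have xE : x = eta x *: xi + u by rewrite /u addrC subrK.
  have pr := curvature_like_pair_sym cK.
  have Kxi3 y z w : K y z xi w = 0 by rewrite s34 Kxi oppr0.
  have Kxi1 y z w : K xi y z w = 0 by rewrite pr Kxi3.
  by rewrite phiu {1 3}xE lK !(curvature_like_linear3 cK lK) !(Kxi1, Kxi3); ring.
have ipu : ip (phi x) (phi x) = ip u u.
  by rewrite -phiu (ca_phi_ip ca) etau mul0r subr0.
rewrite Ku ipu; have [->|u0] := eqVneq u 0.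
  have := (Kscale 0 0 (phi 0) 0 (phi 0)).1.1.1.
  by rewrite scale0r ip0l expr0n mulr0 mul0r.
have su := ca_pos ca u0.
pose r := Num.sqrt (ip u u).
have r0 : r != 0 by rewrite gt_eqF // sqrtr_gt0.
have r2 : r * r = ip u u by rewrite -expr2 sqr_sqrtr // ltW.
have := Khol (u := r^-1 *: u).
rewrite !(ipZl, ipZr) etau mulr0 -r2 mulrA => KE.
have {}KE : r^-1 * (r^-1 * (r^-1 * (r^-1 * K u (phi u) (phi u) u))) = rho.
  by rewrite -KE //; [rewrite phiZ !Kscale|field].
by rewrite s34 -KE; field.
Qed.

(** The difference of the two sides satisfies the hypotheses of
    kaehler_curvature_eq0: both tensors have the same symmetries, kill xi and
    agree on the planes spanned by x and phi x. *)
Lemma space_form_curvature x y z w :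
  K x y z w = rho / 4 * space_form_tensor x y z w.
Proof.
have [T12 T34 TB] := space_form_tensor_curvature_like.
have [s12 s34 B] := cK.
pose D x y z w := K x y z w - rho / 4 * space_form_tensor x y z w.
suff D0 : D x y z w = 0 by apply/eqP; rewrite -subr_eq0; apply/eqP.
apply: (@kaehler_curvature_eq0 _ _ D _ _ phi xi (fun x => eta x)).
- split; rewrite /D => {}x {}y {}z {}w.
  + by rewrite s12 T12; ring.
  + by rewrite s34 T34; ring.
  + have := B x y z w; have := TB x y z w.
    move: (K x _ _ _) (K y _ _ _) (K z _ _ _) => a b c.
    move: (space_form_tensor x _ _ _) (space_form_tensor y _ _ _) => a' b'.
    move: (space_form_tensor z _ _ _) => c' h1 h2.
    have -> : a = - b - c by lra.
    have -> : a' = - b' - c' by lra.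
    ring.
- by move=> a {}x x' {}y {}z {}w; rewrite /D lK space_form_tensor_linear; ring.
- exact: phiD.
- exact: phiN.
- exact: ca_phi2 ca.
- by move=> {}x {}y {}z {}w; rewrite /D Kphi space_form_tensor_phi.
- by move=> {}x {}y {}z; rewrite /D Kxi space_form_tensor_xi; ring.
- by move=> {}x; rewrite /D Khol_scaled space_form_tensor_hol; field.
Qed.

End SpaceFormTensor.

(** * A calculus of directional derivatives *)

Section TypedDerivatives.
Local Open Scope classical_set_scope.
Local Open Scope ring_scope.
Variables (R : realType) (k : nat).
Implicit Types (v x : 'rV[R]_k).

(** Fixing the codomain as a type of matrices over R lets derivatives take part
    in matrix products over the ring R itself. *)
Definition mderive p q v (f : 'rV[R]_k -> 'M[R]_(p, q)) x : 'M[R]_(p, q) :=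
  'D_v f x.
Definition mdiff p q (f : 'rV[R]_k -> 'M[R]_(p, q)) x : Prop :=
  differentiable f x.
Definition sderive v (f : 'rV[R]_k -> R) x : R := 'D_v f x.
Definition sdiff (f : 'rV[R]_k -> R) x : Prop := differentiable f x.

Lemma mdiff_cst p q (c : 'M[R]_(p, q)) x : mdiff (fun=> c) x.
Proof. exact: differentiable_cst. Qed.

Lemma mderive_cst p q (c : 'M[R]_(p, q)) v x : mderive v (fun=> c) x = 0.
Proof. exact: derive_cst. Qed.

Lemma mdiffD p q (f h : 'rV[R]_k -> 'M[R]_(p, q)) x :
  mdiff f x -> mdiff h x -> mdiff (fun y => f y + h y) x.
Proof. exact: differentiableD. Qed.

Lemma mderiveD p q (f h : 'rV[R]_k -> 'M[R]_(p, q)) v x :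
  mdiff f x -> mdiff h x ->
  mderive v (fun y => f y + h y) x = mderive v f x + mderive v h x.
Proof. by move=> df dh; apply: deriveD; apply: diff_derivable. Qed.

Lemma mdiffB p q (f h : 'rV[R]_k -> 'M[R]_(p, q)) x :
  mdiff f x -> mdiff h x -> mdiff (fun y => f y - h y) x.
Proof. exact: differentiableB. Qed.

Lemma mderiveB p q (f h : 'rV[R]_k -> 'M[R]_(p, q)) v x :
  mdiff f x -> mdiff h x ->
  mderive v (fun y => f y - h y) x = mderive v f x - mderive v h x.
Proof. by move=> df dh; apply: deriveB; apply: diff_derivable. Qed.

Lemma mdiffZ p q (f : 'rV[R]_k -> 'M[R]_(p, q)) (c : R) x :
  mdiff f x -> mdiff (fun y => c *: f y) x.
Proof. exact: differentiableZ. Qed.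

Lemma mderiveZ p q (f : 'rV[R]_k -> 'M[R]_(p, q)) (c : R) v x :
  mdiff f x -> mderive v (fun y => c *: f y) x = c *: mderive v f x.
Proof. by move=> df; apply: deriveZ; apply: diff_derivable. Qed.

Lemma mdiffM p q r (A : 'rV[R]_k -> 'M[R]_(p, q)) (B : 'rV[R]_k -> 'M[R]_(q, r))
    x : mdiff A x -> mdiff B x -> mdiff (fun y => A y *m B y) x.
Proof. exact: differentiable_mulmx. Qed.

Lemma mderiveM p q r (A : 'rV[R]_k -> 'M[R]_(p, q))
    (B : 'rV[R]_k -> 'M[R]_(q, r)) v x : mdiff A x -> mdiff B x ->
  mderive v (fun y => A y *m B y) x = mderive v A x *m B x + A x *m mderive v B x.
Proof. exact: derive_mulmx. Qed.

Lemma mdiff_tr p q (A : 'rV[R]_k -> 'M[R]_(p, q)) x :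
  mdiff A x -> mdiff (fun y => (A y)^T) x.
Proof. exact: differentiable_trmx. Qed.

Lemma mderive_tr p q (A : 'rV[R]_k -> 'M[R]_(p, q)) v x :
  mdiff A x -> mderive v (fun y => (A y)^T) x = (mderive v A x)^T.
Proof. exact: derive_trmx. Qed.

Lemma mderive_linear p q (A : 'rV[R]_k -> 'M[R]_(p, q)) a u v x :
  mdiff A x -> mderive (a *: u + v) A x = a *: mderive u A x + mderive v A x.
Proof. exact: derive_linear. Qed.

Lemma mderive_sum_ebasis p q (A : 'rV[R]_k -> 'M[R]_(p, q)) v x :
  mdiff A x -> mderive v A x = \sum_i v 0 i *: mderive (ebasis R i) A x.
Proof. exact: derive_sum_ebasis. Qed.

Lemma mdiff_entries p q (A : 'rV[R]_k -> 'M[R]_(p, q)) x :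
  (forall i j, sdiff (fun y => A y i j) x) -> mdiff A x.
Proof. exact: differentiable_mx. Qed.

Lemma sdiff_entry p q (A : 'rV[R]_k -> 'M[R]_(p, q)) x i j :
  mdiff A x -> sdiff (fun y => A y i j) x.
Proof. exact: differentiable_entry. Qed.

Lemma sderive_entry p q (A : 'rV[R]_k -> 'M[R]_(p, q)) v x i j :
  mdiff A x -> sderive v (fun y => A y i j) x = mderive v A x i j.
Proof. by move=> dA; apply/esym/derive_entry/diff_derivable. Qed.

Lemma mdiff_invmx p (A : 'rV[R]_k -> 'M[R]_p) x :
  (\forall y \near x, A y \in unitmx) -> mdiff A x ->
  mdiff (fun y => invmx (A y)) x.
Proof. exact: differentiable_invmx. Qed.

Lemma mdiff_near p q (f h : 'rV[R]_k -> 'M[R]_(p, q)) x :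
  (\forall y \near x, f y = h y) -> mdiff f x -> mdiff h x.
Proof. exact: near_eq_differentiable. Qed.

Lemma mderive_near p q (f h : 'rV[R]_k -> 'M[R]_(p, q)) v x :
  (\forall y \near x, f y = h y) -> mderive v f x = mderive v h x.
Proof. exact: near_eq_derive. Qed.

Lemma sdiff_near (f h : 'rV[R]_k -> R) x :
  (\forall y \near x, f y = h y) -> sdiff f x -> sdiff h x.
Proof. exact: near_eq_differentiable. Qed.

Lemma sderive_near (f h : 'rV[R]_k -> R) v x :
  (\forall y \near x, f y = h y) -> sderive v f x = sderive v h x.
Proof. exact: near_eq_derive. Qed.

Lemma sdiff_cst c x : sdiff (fun=> c) x.
Proof. exact: differentiable_cst. Qed.

Lemma sderive_cst c v x : sderive v (fun=> c) x = 0.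
Proof. exact: derive_cst. Qed.

Lemma sdiffD (f h : 'rV[R]_k -> R) x :
  sdiff f x -> sdiff h x -> sdiff (fun y => f y + h y) x.
Proof. exact: differentiableD. Qed.

Lemma sderiveD (f h : 'rV[R]_k -> R) v x : sdiff f x -> sdiff h x ->
  sderive v (fun y => f y + h y) x = sderive v f x + sderive v h x.
Proof. by move=> df dh; apply: deriveD; apply: diff_derivable. Qed.

Lemma sdiffB (f h : 'rV[R]_k -> R) x :
  sdiff f x -> sdiff h x -> sdiff (fun y => f y - h y) x.
Proof. exact: differentiableB. Qed.

Lemma sderiveB (f h : 'rV[R]_k -> R) v x : sdiff f x -> sdiff h x ->
  sderive v (fun y => f y - h y) x = sderive v f x - sderive v h x.
Proof. by move=> df dh; apply: deriveB; apply: diff_derivable. Qed.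

Lemma sdiffM (f h : 'rV[R]_k -> R) x :
  sdiff f x -> sdiff h x -> sdiff (fun y => f y * h y) x.
Proof. exact: differentiableM. Qed.

Lemma sderiveM (f h : 'rV[R]_k -> R) v x : sdiff f x -> sdiff h x ->
  sderive v (fun y => f y * h y) x = sderive v f x * h x + f x * sderive v h x.
Proof.
move=> df dh; rewrite addrC [_ * h x]mulrC.
by apply: deriveM; apply: diff_derivable.
Qed.

(** The product rule for a coefficient of the quadratic form: h stands for
    |H|^2, which is constant to first order. *)
Lemma sderive_quadratic c1 c2 c3 (h s a b p q : 'rV[R]_k -> R) v x :
  sdiff h x -> sdiff s x -> sdiff a x -> sdiff b x -> sdiff p x -> sdiff q x ->
  sderive v h x = 0 ->
  sderive v (fun y => c1 * h y * s y - c2 * h y * a y * b y + c3 * p y * q y) x =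
  c1 * h x * sderive v s x
  - c2 * h x * (sderive v a x * b x + a x * sderive v b x)
  + c3 * (sderive v p x * q x + p x * sderive v q x).
Proof.
move=> dh ds da db dp dq h0.
have dc c (w : 'rV[R]_k -> R) : sdiff w x -> sdiff (fun y => c * w y) x.
  by move=> dw; exact: sdiffM (sdiff_cst _ _) dw.
have Dc c (w : 'rV[R]_k -> R) : sdiff w x ->
    sderive v (fun y => c * w y) x = c * sderive v w x.
  by move=> dw; rewrite (sderiveM v (sdiff_cst c x) dw) sderive_cst mul0r add0r.
rewrite (sderiveD v (sdiffB (sdiffM (dc _ _ dh) ds)
  (sdiffM (sdiffM (dc _ _ dh) da) db)) (sdiffM (dc _ _ dp) dq)).
rewrite (sderiveB v (sdiffM (dc _ _ dh) ds) (sdiffM (sdiffM (dc _ _ dh) da) db)).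
rewrite (sderiveM v (dc _ _ dh) ds) (sderiveM v (sdiffM (dc _ _ dh) da) db).
rewrite (sderiveM v (dc _ _ dh) da) (sderiveM v (dc _ _ dp) dq).
by rewrite (Dc c1 h dh) (Dc c2 h dh) (Dc c3 p dp) h0; ring.
Qed.

Lemma sdiffV (f : 'rV[R]_k -> R) x :
  f x != 0 -> sdiff f x -> sdiff (fun y => (f y)^-1) x.
Proof. by move=> f0 df; apply: differentiableV. Qed.

Lemma mdiffZl p q (a : 'rV[R]_k -> R) (A : 'rV[R]_k -> 'M[R]_(p, q)) x :
  sdiff a x -> mdiff A x -> mdiff (fun y => a y *: A y) x.
Proof.
move=> da dA; apply: mdiff_entries => i j.
rewrite (_ : (fun y => _) = (fun y => a y * A y i j)).
  exact: sdiffM da (sdiff_entry i j dA).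
by apply/funext => y; rewrite mxE.
Qed.

Lemma mderiveZl p q (a : 'rV[R]_k -> R) (A : 'rV[R]_k -> 'M[R]_(p, q)) v x :
  sdiff a x -> mdiff A x -> mderive v (fun y => a y *: A y) x =
  sderive v a x *: A x + a x *: mderive v A x.
Proof.
move=> da dA; apply/matrixP => i j.
rewrite -(sderive_entry v i j (mdiffZl da dA)).
have -> : (fun y => (a y *: A y) i j) = (fun y => a y * A y i j).
  by apply/funext => y; rewrite mxE.
rewrite (sderiveM v da (sdiff_entry i j dA)) (sderive_entry v i j dA).
by rewrite mxE [X in _ = X + _]mxE [X in _ = _ + X]mxE.
Qed.

Lemma mdiff_sum p q n (A : 'I_n -> 'rV[R]_k -> 'M[R]_(p, q)) x :
  (forall i, mdiff (A i) x) -> mdiff (fun y => \sum_i A i y) x.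
Proof. exact: differentiable_sumfun. Qed.

Lemma mderive_sum p q n (A : 'I_n -> 'rV[R]_k -> 'M[R]_(p, q)) v x :
  (forall i, mdiff (A i) x) ->
  mderive v (fun y => \sum_i A i y) x = \sum_i mderive v (A i) x.
Proof.
move=> dA; rewrite /mderive.
have -> : (fun y => \sum_i A i y) = \sum_i A i.
  by apply/funext => y; rewrite fct_sumE.
by apply: derive_sum => i; apply: diff_derivable; exact: dA.
Qed.

Lemma smooth_mdiff p q (U : set 'rV[R]_k) (M : 'rV[R]_k -> 'M[R]_(p, q)) x :
  open U -> smooth_on U M -> U x -> mdiff M x.
Proof. exact: smooth_differentiable. Qed.

Lemma smooth_mdiff_mderive p q (U : set 'rV[R]_k) (M : 'rV[R]_k -> 'M[R]_(p, q))
    x v : open U -> smooth_on U M -> U x -> mdiff (mderive v M) x.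
Proof. by move=> oU sM Ux; have D := smooth_differentiable_derive oU sM Ux v; apply: D. Qed.

Lemma smooth_mderive_comm p q (U : set 'rV[R]_k) (M : 'rV[R]_k -> 'M[R]_(p, q))
    x u v : open U -> smooth_on U M -> U x ->
  mderive u (mderive v M) x = mderive v (mderive u M) x.
Proof. by move=> oU sM Ux; have D := smooth_derive_comm oU sM Ux u v; apply: D. Qed.

Lemma smooth_partial p q (U : set 'rV[R]_k) (M : 'rV[R]_k -> 'M[R]_(p, q)) i :
  smooth_on U M -> smooth_on U (mderive (ebasis R i) M).
Proof. exact: smooth_on_partial. Qed.

Lemma open_near (U : set 'rV[R]_k) (P : 'rV[R]_k -> Prop) x :
  open U -> U x -> (forall y, U y -> P y) -> \forall y \near x, P y.
Proof. by move=> oU Ux UP; apply: filterS (near_of_open oU Ux) => y; exact: UP. Qed.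

End TypedDerivatives.

Lemma mdiff_comp (R : realType) (k m p q : nat) (F : 'rV[R]_k -> 'rV[R]_m)
    (A : 'rV[R]_m -> 'M[R]_(p, q)) y :
  mdiff F y -> mdiff A (F y) -> mdiff (fun z => A (F z)) y.
Proof. exact: differentiable_comp. Qed.

Lemma mderive_comp (R : realType) (k m p q : nat) (F : 'rV[R]_k -> 'rV[R]_m)
    (A : 'rV[R]_m -> 'M[R]_(p, q)) v y :
  mdiff F y -> mdiff A (F y) ->
  mderive v (fun z => A (F z)) y = mderive (mderive v F y) A (F y).
Proof.
move=> dF dA; rewrite /mderive deriveE; last exact: differentiable_comp.
rewrite (diff_comp dF dA) /= -deriveE; last exact: dA.
by rewrite -deriveE //; exact: dF.
Qed.


(** * Matrix identities and bilinear forms *)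

(** Products become variables; what is left is an identity of sums, checked
    entry by entry. *)
Ltac mx_abel :=
  repeat match goal with
  | |- context [@mulmx ?S ?m ?n ?p ?A ?B] =>
      generalize (@mulmx S m n p A B); intro
  end;
  apply/matrixP => ? ?; rewrite !mxE; ring.

(** The expansion rules at the ring structure of R itself, so that equal
    products become equal terms. *)
Section MatrixExpansion.
Local Open Scope ring_scope.
Variables (R : realType) (m n p q : nat).
Implicit Types (A : 'M[R]_(m, n)) (B : 'M[R]_(n, p)) (C : 'M[R]_(p, q)).

Lemma mxDl A A' B : (A + A') *m B = A *m B + A' *m B.
Proof. exact: mulmxDl. Qed.
Lemma mxDr A B B' : A *m (B + B') = A *m B + A *m B'.
Proof. exact: mulmxDr. Qed.
Lemma mxNl A B : (- A) *m B = - (A *m B).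
Proof. exact: mulNmx. Qed.
Lemma mxNr A B : A *m (- B) = - (A *m B).
Proof. exact: mulmxN. Qed.
Lemma mxZl a A B : (a *: A) *m B = a *: (A *m B).
Proof. by rewrite scalemxAl. Qed.
Lemma mxZr a A B : A *m (a *: B) = a *: (A *m B).
Proof. by rewrite scalemxAr. Qed.
Lemma mxA A B C : A *m (B *m C) = A *m B *m C.
Proof. exact: mulmxA. Qed.
Lemma mx0l B : (0 : 'M[R]_(m, n)) *m B = 0.
Proof. exact: mul0mx. Qed.
Lemma mxTM A B : (A *m B)^T = B^T *m A^T.
Proof. exact: trmx_mul. Qed.
Lemma mxTD A A' : (A + A')^T = A^T + A'^T.
Proof. exact: linearD. Qed.
Lemma mxTN A : (- A)^T = - A^T.
Proof. exact: linearN. Qed.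
End MatrixExpansion.

Ltac mx_expand :=
  rewrite ?(mxTM, mxTD, mxTN) ?(mxDl, mxDr, mxNl, mxNr, mxZl, mxZr) ?mxA;
  mx_abel.

Section BilinearForm.
Local Open Scope ring_scope.
Variables (R : realType) (m : nat).
Implicit Types (A : 'M[R]_m) (u v w : 'rV[R]_m).

Lemma bform_linl A a u v w :
  bform A (a *: u + v) w = a * bform A u w + bform A v w.
Proof. by rewrite /bform !mulmxDl -!scalemxAl !mxE. Qed.

Lemma bform_sym A u v : A^T = A -> bform A u v = bform A v u.
Proof.
move=> AT; rewrite /bform -[u *m A *m v^T in LHS]trmxK [LHS]mxE.
by rewrite !trmx_mul trmxK AT mulmxA.
Qed.

Lemma bform_mull A (B : 'M[R]_m) u v : bform (B *m A) u v = bform A (u *m B) v.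
Proof. by rewrite /bform mulmxA. Qed.

Lemma bform_mulr A (B : 'M[R]_m) u v : bform (A *m B^T) u v = bform A u (v *m B).
Proof. by rewrite /bform trmx_mul !mulmxA. Qed.

Lemma bformDmx A (B : 'M[R]_m) u v : bform (A + B) u v = bform A u v + bform B u v.
Proof. by rewrite /bform mulmxDr mulmxDl mxE. Qed.

Lemma bform0mx u v : bform 0 u v = 0.
Proof. by rewrite /bform mulmx0 mul0mx mxE. Qed.

Lemma bform_ebasis A u l : bform A u (ebasis R l) = (u *m A) 0 l.
Proof. by rewrite /bform /ebasis trmx_delta -colE mxE. Qed.

Lemma posdef_unitmx A :
  (forall u : 'rV[R]_m, u != 0 -> 0 < bform A u u) -> A \in unitmx.
Proof.
move=> Apos; rewrite -row_free_unit -kermx_eq0; apply/rowV0P => u /sub_kermxP uA.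
apply/eqP; apply: contraT => /Apos.
by rewrite /bform uA mul0mx mxE ltxx.
Qed.
End BilinearForm.

(** * The Levi-Civita connection in coordinates *)

Section Christoffel.
Local Open Scope classical_set_scope.
Local Open Scope ring_scope.
Variables (R : realType) (m : nat) (U : set 'rV[R]_m) (g : 'rV[R]_m -> 'M[R]_m).
Hypotheses (oU : open U) (sg : smooth_on U g).
Hypothesis gT : forall x, U x -> (g x)^T = g x.
Hypothesis gpos :
  forall x, U x -> forall u : 'rV[R]_m, u != 0 -> 0 < bform (g x) u u.
Implicit Types (x u v w : 'rV[R]_m).

Let g_unit x : U x -> g x \in unitmx.
Proof. by move=> Ux; apply: posdef_unitmx; exact: gpos. Qed.

Let dg x : U x -> mdiff g x. Proof. exact: smooth_mdiff oU sg. Qed.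

Let dDg v x : U x -> mdiff (mderive v g) x.
Proof. exact: smooth_mdiff_mderive oU sg. Qed.

Let DgT v x : U x -> (mderive v g x)^T = mderive v g x.
Proof.
move=> Ux; rewrite -(mderive_tr v (dg Ux)).
by apply: mderive_near; apply: open_near oU Ux gT.
Qed.

(** The bilinear form (w, v) |-> (d_w g)(u, v). *)
Definition gmixed x u : 'M[R]_m :=
  \matrix_(k, l) (u *m mderive (ebasis R k) g x) 0 l.

Lemma gmixedE x u k l : gmixed x u k l = (u *m mderive (ebasis R k) g x) 0 l.
Proof. by rewrite mxE. Qed.

(** The Koszul formula as a matrix: half the sum of d_u g and of gmixed minus
    its transpose, with an index raised. Tangent vectors being rows, the product
    of the row w with conn_form x u is the Christoffel symbol on (u, w). *)
Definition conn_form x u : 'M[R]_m :=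
  locked (2^-1 *: (mderive u g x + gmixed x u - (gmixed x u)^T) *m invmx (g x)).

Lemma conn_formE x u : conn_form x u =
  2^-1 *: (mderive u g x + gmixed x u - (gmixed x u)^T) *m invmx (g x).
Proof. by rewrite /conn_form -lock. Qed.

Lemma nablaE X Y x :
  nabla g X Y x = mderive (X x) Y x + christoffel g x (X x) (Y x).
Proof. by []. Qed.

Lemma christoffel_mderive x u w : christoffel g x u w =
  (\row_l (2^-1 * (bform (mderive u g x) w (ebasis R l)
                   + bform (mderive w g x) u (ebasis R l)
                   - bform (mderive (ebasis R l) g x) u w))) *m invmx (g x).
Proof. by []. Qed.

Lemma christoffelE x u w : U x -> christoffel g x u w = w *m conn_form x u.
Proof.
move=> Ux; rewrite christoffel_mderive conn_formE mulmxA; congr (_ *m _).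
apply/rowP => l; rewrite mxE -scalemxAr mxE mulmxBr mulmxDr.
have addE (A B C : 'rV[R]_m) : (A + B - C) 0 l = A 0 l + B 0 l - C 0 l.
  by rewrite !mxE.
rewrite addE; congr (_ * (_ + _ - _)).
- exact: bform_ebasis.
- rewrite bform_ebasis (mderive_sum_ebasis w (dg Ux)).
  rewrite mulmx_sumr summxE mxE.
  by apply: eq_bigr => k _; rewrite -scalemxAr !mxE.
- rewrite /bform mxE [RHS]mxE; apply: eq_bigr => k _.
  by rewrite mxE [_^T _ _]mxE [_^T _ _]mxE [gmixed _ _ _ _]mxE mxE mulrC.
Qed.

Lemma conn_form_linear x a u v : U x ->
  conn_form x (a *: u + v) = a *: conn_form x u + conn_form x v.
Proof.
move=> Ux; rewrite !conn_formE (mderive_linear _ _ _ (dg Ux)).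
have -> : gmixed x (a *: u + v) = a *: gmixed x u + gmixed x v.
  apply/matrixP => i j; rewrite [RHS]mxE [X in _ = X + _]mxE !gmixedE.
  by rewrite mulmxDl -scalemxAl [LHS]mxE [X in X + _]mxE.
rewrite scalemxAl -mulmxDl; congr (_ *m _).
move: (gmixed x u) (gmixed x v) (mderive u g x) (mderive v g x) => P Q A B.
by apply/matrixP => i j; rewrite !mxE; ring.
Qed.

(** The part of the Koszul formula other than d_u g is skew, so it cancels
    against its transpose. *)
Lemma conn_form_metric x u : U x ->
  mderive u g x = conn_form x u *m g x + g x *m (conn_form x u)^T.
Proof.
move=> Ux; rewrite conn_formE trmx_mul trmx_inv (gT Ux).
rewrite mulmxKV ?g_unit // mulKVmx ?g_unit //.
move: (gmixed x u) (mderive u g x) (DgT u Ux) => P A AT.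
apply/matrixP => i j; have := congr1 (fun B : 'M[R]_m => B i j) AT.
by rewrite !mxE => ->; field.
Qed.

Lemma conn_form_torsion x u w : U x -> w *m conn_form x u = u *m conn_form x w.
Proof.
move=> Ux; rewrite -!christoffelE // !christoffel_mderive; congr (_ *m _).
apply/rowP => l; rewrite mxE [RHS]mxE.
have swap (a b c c' : R) : c = c' -> 2^-1 * (a + b - c) = 2^-1 * (b + a - c').
  by move=> ->; rewrite [a + b]addrC.
exact: swap (bform_sym u w (DgT _ Ux)).
Qed.

Lemma mdiff_conn_form x u : U x -> mdiff (conn_form^~ u) x.
Proof.
move=> Ux; under eq_fun do rewrite conn_formE.
apply: mdiffM; last first.
  by apply: mdiff_invmx (dg Ux); apply: open_near oU Ux g_unit.
have dm : mdiff (gmixed^~ u) x.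
  apply: mdiff_entries => k l.
  under eq_fun do rewrite gmixedE.
  by apply: sdiff_entry; apply: mdiffM; [exact: mdiff_cst|exact: dDg].
apply: mdiffZ; apply: mdiffB; last exact: mdiff_tr.
by apply: mdiffD => //; exact: dDg.
Qed.

(** The curvature operator as a matrix acting on rows, hence the order of the
    factors. *)
Definition curv x u v : 'M[R]_m :=
  locked (mderive u (conn_form^~ v) x - mderive v (conn_form^~ u) x
    + conn_form x v *m conn_form x u - conn_form x u *m conn_form x v).

Lemma curvE x u v : curv x u v =
  mderive u (conn_form^~ v) x - mderive v (conn_form^~ u) x
  + conn_form x v *m conn_form x u - conn_form x u *m conn_form x v.
Proof. by rewrite /curv -lock. Qed.

Lemma curvatureE x u v w : U x ->
  curvature g (fun=> u) (fun=> v) (fun=> w) x = w *m curv x u v.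
Proof.
move=> Ux.
have nab_cst a b y : U y -> nabla g (fun=> a) (fun=> b) y = b *m conn_form y a.
  by move=> Uy; rewrite nablaE mderive_cst add0r christoffelE.
have nab2 a b : nabla g (fun=> a) (nabla g (fun=> b) (fun=> w)) x =
    w *m mderive a (conn_form^~ b) x + w *m conn_form x b *m conn_form x a.
  rewrite nablaE christoffelE // nab_cst //.
  rewrite (@mderive_near _ _ _ _ (nabla g (fun=> b) (fun=> w))
    (fun y => w *m conn_form y b)); last first.
    by apply: open_near oU Ux _ => y; exact: nab_cst.
  rewrite mderiveM; [|exact: mdiff_cst|exact: mdiff_conn_form].
  by rewrite mderive_cst mul0mx add0r.
(* constant fields commute *)
have nab0 : nabla g (lie_bracket (fun=> u) (fun=> v)) (fun=> w) x = 0.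
  have -> : lie_bracket (fun=> u) (fun=> v) = (fun=> 0 : 'rV[R]_m).
    apply/funext => y; rewrite /lie_bracket.
    have -> : 'D_u (fun=> v) y = 0 :> 'rV[R]_m by exact: mderive_cst.
    have -> : 'D_v (fun=> u) y = 0 :> 'rV[R]_m by exact: mderive_cst.
    exact: subrr.
  rewrite nab_cst //.
  have := conn_form_linear (-1) 0 0 Ux; rewrite scaler0 addr0 scaleN1r addNr => ->.
  by rewrite mulmx0.
rewrite /curvature nab0 !nab2 subr0 !curvE.
generalize (mderive u (conn_form^~ v) x) (mderive v (conn_form^~ u) x)
  (conn_form x u) (conn_form x v) => A B C D.
mx_expand.
Qed.

Lemma curv_skew x u v : curv x u v = - curv x v u.
Proof.
rewrite !curvE.
generalize (mderive u (conn_form^~ v) x) (mderive v (conn_form^~ u) x)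
  (conn_form x u) (conn_form x v) => A B C D.
mx_abel.
Qed.

Lemma curv_linear x a u u' v : U x ->
  curv x (a *: u + u') v = a *: curv x u v + curv x u' v.
Proof.
move=> Ux; rewrite !curvE (mderive_linear _ _ _ (mdiff_conn_form v Ux)).
have -> : mderive v (conn_form^~ (a *: u + u')) x =
    a *: mderive v (conn_form^~ u) x + mderive v (conn_form^~ u') x.
  have du := mdiff_conn_form u Ux; have du' := mdiff_conn_form u' Ux.
  rewrite -(mderiveZ a v du) -(mderiveD v (mdiffZ a du) du').
  by apply: mderive_near; apply: open_near oU Ux _ => y; exact: conn_form_linear.
rewrite (conn_form_linear _ _ _ Ux).
generalize (mderive u (conn_form^~ v) x) (mderive u' (conn_form^~ v) x)
  (mderive v (conn_form^~ u) x) (mderive v (conn_form^~ u') x)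
  (conn_form x u) (conn_form x u') (conn_form x v) => A A' B B' C C' D.
mx_expand.
Qed.

(** By the absence of torsion the arguments u and w of w *m conn_form x u can be
    exchanged, also under a derivative; the terms then cancel in pairs. *)
Lemma curv_bianchi x u v w : U x ->
  w *m curv x u v + u *m curv x v w + v *m curv x w u = 0.
Proof.
move=> Ux.
have D a b c : c *m mderive a (conn_form^~ b) x = b *m mderive a (conn_form^~ c) x.
  have E c' b' : c' *m mderive a (conn_form^~ b') x =
      mderive a (fun y => c' *m conn_form y b') x.
    rewrite mderiveM; [|exact: mdiff_cst|exact: mdiff_conn_form].
    by rewrite mderive_cst mul0mx add0r.
  rewrite !E; apply: mderive_near; apply: open_near oU Ux _ => y Uy.
  exact: conn_form_torsion.
move: (D u v w) (D v w u) (D w u v) (conn_form_torsion v w Ux).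
move: (conn_form_torsion u w Ux) (conn_form_torsion v u Ux).
rewrite !curvE.
generalize (mderive u (conn_form^~ v) x) (mderive u (conn_form^~ w) x)
  (mderive v (conn_form^~ u) x) (mderive v (conn_form^~ w) x)
  (mderive w (conn_form^~ u) x) (mderive w (conn_form^~ v) x)
  (conn_form x u) (conn_form x v) (conn_form x w) => A A' B B' C C' D1 D2 D3.
move=> T1 T2 T3 E1 E2 E3; rewrite !(mxDr, mxNr) !mxA E1 E2 E3 T1 T2 T3.
mx_abel.
Qed.

(** Second derivatives of g commute; expressing them with conn_form_metric, the
    commutator is the left-hand side. *)
Lemma curv_metric x u v : U x ->
  curv x u v *m g x + g x *m (curv x u v)^T = 0.
Proof.
move=> Ux.
have DD a b : mderive a (mderive b g) x =
    mderive a (conn_form^~ b) x *m g x + conn_form x b *m mderive a g x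
    + mderive a g x *m (conn_form x b)^T + g x *m (mderive a (conn_form^~ b) x)^T.
  have dG := mdiff_conn_form b Ux.
  rewrite (@mderive_near _ _ _ _ (mderive b g)
    (fun y => conn_form y b *m g y + g y *m (conn_form y b)^T)); last first.
    by apply: open_near oU Ux _ => y Uy; exact: conn_form_metric.
  rewrite mderiveD; last 2 first.
  - exact: mdiffM dG (dg Ux).
  - exact: mdiffM (dg Ux) (mdiff_tr dG).
  rewrite (mderiveM _ dG (dg Ux)) (mderiveM _ (dg Ux) (mdiff_tr dG)).
  by rewrite (mderive_tr _ dG) addrA.
have := smooth_mderive_comm u v oU sg Ux; rewrite !DD.
rewrite !(conn_form_metric _ Ux) => /eqP; rewrite -subr_eq0 => /eqP E.
rewrite -[RHS]E !curvE.
generalize (mderive u (conn_form^~ v) x) (mderive v (conn_form^~ u) x)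
  (conn_form x u) (conn_form x v) (g x) => A B C D G.
mx_expand.
Qed.

Section Parallel.
Variable phi : 'rV[R]_m -> 'M[R]_m.
Hypothesis sphi : smooth_on U phi.
Hypothesis phi_parallel : forall x u, U x ->
  mderive u phi x = conn_form x u *m phi x - phi x *m conn_form x u.

(** The same argument as for the metric, applied to the parallel tensor phi. *)
Lemma curv_phi x u v : U x -> curv x u v *m phi x = phi x *m curv x u v.
Proof.
move=> Ux.
have dphi := smooth_mdiff oU sphi Ux.
have DD a b : mderive a (mderive b phi) x =
    mderive a (conn_form^~ b) x *m phi x + conn_form x b *m mderive a phi x
    - (mderive a phi x *m conn_form x b + phi x *m mderive a (conn_form^~ b) x).
  have dG := mdiff_conn_form b Ux.
  rewrite (@mderive_near _ _ _ _ (mderive b phi)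
    (fun y => conn_form y b *m phi y - phi y *m conn_form y b)); last first.
    by apply: open_near oU Ux _ => y Uy; exact: phi_parallel.
  rewrite mderiveB; last 2 first.
  - exact: mdiffM dG dphi.
  - exact: mdiffM dphi dG.
  by rewrite (mderiveM _ dG dphi) (mderiveM _ dphi dG).
have := smooth_mderive_comm u v oU sphi Ux; rewrite !DD.
rewrite !(phi_parallel _ Ux) => /eqP; rewrite -subr_eq0 => /eqP E.
apply/eqP; rewrite -subr_eq0; apply/eqP; rewrite -[RHS]E !curvE.
generalize (mderive u (conn_form^~ v) x) (mderive v (conn_form^~ u) x)
  (conn_form x u) (conn_form x v) (phi x) => A B C D G.
mx_expand.
Qed.
End Parallel.
End Christoffel.

(** * Cosymplectic space forms in coordinates *)

Section DeriveBform.
Local Open Scope ring_scope.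

(** The last hypothesis says that G is parallel for the connection with matrix A;
    then the scalar product is differentiated with covariant derivatives. *)
Lemma mderive_bform (R : realType) (k m : nat) (y : 'rV[R]_k) v
    (G : 'rV[R]_k -> 'M[R]_m)
    (V W : 'rV[R]_k -> 'rV[R]_m) (A : 'M[R]_m) :
  mdiff G y -> mdiff V y -> mdiff W y ->
  mderive v G y = A *m G y + G y *m A^T ->
  sdiff (fun z => bform (G z) (V z) (W z)) y /\
  sderive v (fun z => bform (G z) (V z) (W z)) y =
    bform (G y) (mderive v V y + V y *m A) (W y) +
    bform (G y) (V y) (mderive v W y + W y *m A).
Proof.
move=> dG dV dW DG.
have dVG := mdiffM dV dG; have dVGW := mdiffM dVG (mdiff_tr dW).
split; first exact: sdiff_entry dVGW.
rewrite /bform (sderive_entry _ _ _ dVGW) (mderiveM _ dVG (mdiff_tr dW)).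
rewrite (mderiveM _ dV dG) (mderive_tr _ dW) DG.
generalize (mderive v V y) (mderive v W y) (V y) (W y) (G y) => DV DW a b C.
have addE (M N : 'M[R]_1) : M 0 0 + N 0 0 = (M + N) 0 0 by rewrite mxE.
rewrite addE; congr (fun_of_matrix _ 0 0); mx_expand.
Qed.

End DeriveBform.

(** What the hypotheses on the ambient manifold say in one chart. *)
Record space_form_coordinates (R : realType) (m : nat) (U : set 'rV[R]_m)
    (g phi : 'rV[R]_m -> 'M[R]_m) (xi : 'rV[R]_m -> 'rV[R]_m) (rho : R) : Prop :=
  SpaceFormCoordinates {
  sfc_open : open U;
  sfc_g_smooth : smooth_on U g;
  sfc_phi_smooth : smooth_on U phi;
  sfc_xi_smooth : smooth_on U xi;
  sfc_g_sym : forall x, U x -> (g x)^T%R = g x;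
  sfc_g_pos : forall x, U x ->
    forall u : 'rV[R]_m, (u != 0 -> 0 < bform (g x) u u)%R;
  sfc_contact : forall x, U x ->
    [/\ bform (g x) (xi x) (xi x) = 1%R,
        forall u : 'rV[R]_m,
          (u *m phi x *m phi x = - u + bform (g x) u (xi x) *: xi x)%R &
        forall u v : 'rV[R]_m, (bform (g x) (u *m phi x) (v *m phi x) =
          bform (g x) u v - bform (g x) u (xi x) * bform (g x) v (xi x))%R];
  sfc_phi_parallel : forall x u, U x ->
    (mderive u phi x = conn_form g x u *m phi x - phi x *m conn_form g x u)%R;
  sfc_curvature : forall x, U x -> forall u : 'rV[R]_m,
    bform (g x) u u = 1%R -> bform (g x) u (xi x) = 0%R ->
    sectional_curvature g x u (u *m phi x)%R = rho
}.

Section CosymplecticCoordinates.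
Local Open Scope classical_set_scope.
Local Open Scope ring_scope.
Variables (R : realType) (m : nat) (U : set 'rV[R]_m).
Variables (g phi : 'rV[R]_m -> 'M[R]_m) (xi : 'rV[R]_m -> 'rV[R]_m) (rho : R).
Hypothesis hN : space_form_coordinates U g phi xi rho.

Let oU := sfc_open hN.
Let sg := sfc_g_smooth hN.
Let sphi := sfc_phi_smooth hN.
Let sxi := sfc_xi_smooth hN.
Let gT := sfc_g_sym hN.
Let gpos := sfc_g_pos hN.
Let acm := sfc_contact hN.
Let phi_parallel := sfc_phi_parallel hN.
Let hol := sfc_curvature hN.

Lemma contact_algebra_at x : U x ->
  contact_algebra (bform (g x)) (fun u : 'rV[R]_m => u *m phi x) (xi x).
Proof.
move=> Ux; have [xi1 phi2 phiip] := acm Ux; split=> //.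
- by move=> u v; apply: bform_sym; exact: gT.
- by move=> a u v w; exact: bform_linl.
- exact: gpos.
- by move=> a u v; rewrite mulmxDl -scalemxAl.
Qed.

(** Differentiating phi xi = 0 and |xi|^2 = 1 shows that the covariant
    derivative of xi is killed by phi and orthogonal to xi; as
    phi^2 = - id + eta xi, it is zero. *)
Lemma xi_parallel x u : U x -> mderive u xi x + xi x *m conn_form g x u = 0.
Proof.
move=> Ux; have ca := contact_algebra_at Ux; have [xi1 phi2 _] := acm Ux.
have dxi := smooth_mdiff oU sxi Ux; have dphi := smooth_mdiff oU sphi Ux.
have dg := smooth_mdiff oU sg Ux.
set w := _ + _.
have wphi : w *m phi x = 0.
  have : mderive u (fun y => xi y *m phi y) x = 0.
    rewrite (@mderive_near _ _ _ _ _ (fun=> 0)) ?mderive_cst //.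
    by apply: open_near oU Ux _ => y Uy; exact: phi_xi (contact_algebra_at Uy).
  rewrite (mderiveM _ dxi dphi) (phi_parallel _ Ux) => E.
  have p0 : xi x *m phi x = 0 by exact: phi_xi ca.
  by move: E; rewrite mxDr mxNr !mxA p0 mx0l oppr0 addr0 /w mxDl.
have wxi : bform (g x) w (xi x) = 0.
  have [_] := mderive_bform dg dxi dxi (conn_form_metric oU sg gT gpos u Ux).
  rewrite (@sderive_near _ _ _ (fun=> 1)); last first.
    by apply: open_near oU Ux _ => y Uy; have [] := acm Uy.
  rewrite sderive_cst -/w [X in _ = _ + X](bform_sym _ _ (gT Ux)) => E.
  by move: E; move: (bform _ w _) => b; lra.
have := phi2 w; rewrite wphi mx0l wxi scale0r addr0 => /esym/eqP.
by rewrite oppr_eq0 => /eqP.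
Qed.

(** The symmetries needed for space_form_curvature come from the metric, from
    the absence of torsion and from the parallelism of phi: R commutes with phi,
    so R xi is killed by phi, and it is orthogonal to xi by skewness. *)
Lemma space_form_curv x a b z w : U x ->
  bform (g x) (z *m curv g x a b) w =
  rho / 4 * space_form_tensor (bform (g x)) (fun u : 'rV[R]_m => u *m phi x)
    (xi x) a b z w.
Proof.
move=> Ux; have ca := contact_algebra_at Ux; have [xi1 phi2 phiip] := acm Ux.
pose K a b z w := bform (g x) (z *m curv g x a b) w.
have K34 c d u v : K c d u v = - K c d v u.
  have := bform0mx u v; rewrite -(curv_metric oU sg gT gpos c d Ux) bformDmx.
  rewrite bform_mull bform_mulr (bform_sym u _ (gT Ux)) -/(K c d u v).
  by rewrite -/(K c d v u); lra.
have xiC c d : xi x *m curv g x c d = 0.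
  set X := _ *m _.
  have etaX : bform (g x) X (xi x) = 0.
    by have := K34 c d (xi x) (xi x); rewrite /K -/X; lra.
  have phiX : X *m phi x = 0.
    have p0 : xi x *m phi x = 0 by exact: phi_xi ca.
    by rewrite /X -mxA (curv_phi oU sg gpos sphi phi_parallel) // mxA p0 mx0l.
  have := phi2 X; rewrite phiX mx0l etaX scale0r addr0 => /esym/eqP.
  by rewrite oppr_eq0 => /eqP.
have Kxi c d u : K c d u (xi x) = 0.
  by rewrite K34 /K xiC (ip0l ca) oppr0.
apply: (space_form_curvature ca (K := K)).
- split=> //.
  + by move=> c d u v; rewrite /K curv_skew mxNr (ipNl ca).
  + by move=> c d u v; rewrite /K -!(ipDl ca) (curv_bianchi oU sg gT) // (ip0l ca).
- move=> s c c' d u v; rewrite /K (curv_linear oU sg gpos) //.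
  by rewrite mxDr mxZr (ca_lin ca).
- move=> c d u v; rewrite /K -mxA -(curv_phi oU sg gpos sphi phi_parallel) // mxA.
  by rewrite phiip -/(K c d u v) -/(K c d u (xi x)) Kxi mul0r subr0.
- exact: Kxi.
- move=> u u1 uxi; rewrite -(hol Ux u1 uxi) /sectional_curvature.
  rewrite (curvatureE oU sg) // phiip u1 uxi !mulr0 subr0.
  have -> : bform (g x) u (u *m phi x) = 0 by exact: ip_phi_self ca u.
  by rewrite mulr1 expr0n subr0 divr1.
Qed.

End CosymplecticCoordinates.

(** * The ambient connection along a surface *)

Section AlongSurface.
Local Open Scope classical_set_scope.
Local Open Scope ring_scope.
Variables (R : realType) (m : nat) (U : set 'rV[R]_m).
Variables (g phi : 'rV[R]_m -> 'M[R]_m) (xi : 'rV[R]_m -> 'rV[R]_m) (rho : R).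
Hypothesis hN : space_form_coordinates U g phi xi rho.
Variables (D : set 'rV[R]_2) (F : 'rV[R]_2 -> 'rV[R]_m).
Hypotheses (oD : open D) (sF : smooth_on D F) (FU : forall y, D y -> U (F y)).

Let oU := sfc_open hN.
Let sg := sfc_g_smooth hN.
Let gT := sfc_g_sym hN.
Let gpos := sfc_g_pos hN.

Local Notation e i := (ebasis R (i : 'I_2)).
Local Notation f i := (mderive (e i) F).

(** The pull-back of the ambient connection by F, in the i-th coordinate
    direction. *)
Definition cov (i : 'I_2) (V : 'rV[R]_2 -> 'rV[R]_m) y : 'rV[R]_m :=
  mderive (e i) V y + V y *m conn_form g (F y) (f i y).

Local Notation ip y := (bform (g (F y))).

Let dF y : D y -> mdiff F y. Proof. exact: smooth_mdiff oD sF. Qed.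

Lemma mdiff_tangent i y : D y -> mdiff (f i) y.
Proof. by move=> Dy; apply: smooth_mdiff (smooth_partial i sF) Dy. Qed.

Lemma mdiff_along p q (A : 'rV[R]_m -> 'M[R]_(p, q)) y :
  D y -> smooth_on U A -> mdiff (fun z => A (F z)) y.
Proof.
move=> Dy sA; apply: mdiff_comp (dF Dy) _.
exact: smooth_mdiff oU sA (FU Dy).
Qed.

Lemma mderive_along p q (A : 'rV[R]_m -> 'M[R]_(p, q)) i y :
  D y -> smooth_on U A ->
  mderive (e i) (fun z => A (F z)) y = mderive (f i y) A (F y).
Proof.
move=> Dy sA; apply: mderive_comp (dF Dy) _.
exact: smooth_mdiff oU sA (FU Dy).
Qed.

Lemma derive_ip i (V W : 'rV[R]_2 -> 'rV[R]_m) y : D y -> mdiff V y -> mdiff W y ->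
  sderive (e i) (fun z => ip z (V z) (W z)) y =
  ip y (cov i V y) (W y) + ip y (V y) (cov i W y).
Proof.
move=> Dy dV dW; apply: (mderive_bform (mdiff_along Dy sg) dV dW _).2.
rewrite (mderive_along _ Dy sg); exact: (conn_form_metric oU sg gT gpos _ (FU Dy)).
Qed.

Lemma sdiff_ip (V W : 'rV[R]_2 -> 'rV[R]_m) y : D y -> mdiff V y -> mdiff W y ->
  sdiff (fun z => ip z (V z) (W z)) y.
Proof.
move=> Dy dV dW.
exact: sdiff_entry (mdiffM (mdiffM dV (mdiff_along Dy sg)) (mdiff_tr dW)).
Qed.

Lemma cov_phi i (V : 'rV[R]_2 -> 'rV[R]_m) y : D y -> mdiff V y ->
  cov i (fun z => V z *m phi (F z)) y = cov i V y *m phi (F y).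
Proof.
move=> Dy dV; have sphi := sfc_phi_smooth hN; rewrite /cov.
rewrite (mderiveM _ dV (mdiff_along Dy sphi)) (mderive_along _ Dy sphi).
rewrite (sfc_phi_parallel hN _ (FU Dy)).
generalize (mderive (e i) V y) (conn_form g (F y) (f i y)) (phi (F y)) => A B C.
mx_expand.
Qed.

Lemma cov_xi i y : D y -> cov i (fun z => xi (F z)) y = 0.
Proof.
move=> Dy; rewrite /cov (mderive_along _ Dy (sfc_xi_smooth hN)).
by apply: (xi_parallel hN); exact: FU.
Qed.

(** The connection matrix along F depends on two moving arguments; expanding
    the second one over the coordinate basis separates them. *)
Let conn_sum x (w : 'rV[R]_m) : U x ->
  \sum_k w 0 k *: conn_form g x (ebasis R k) = conn_form g x w.
Proof.
move=> Ux; rewrite [in RHS](row_sum_ebasis w).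
have conn0 : conn_form g x 0 = 0.
  have := conn_form_linear oU sg (-1) 0 0 Ux.
  by rewrite scaler0 addr0 scaleN1r addNr.
elim/big_rec2: _ => [|k A B _ ->]; first exact/esym.
by rewrite (conn_form_linear oU sg).
Qed.

Let conn_sum_near (V : 'rV[R]_2 -> 'rV[R]_m) y : D y -> \forall z \near y,
  \sum_k V z 0 k *: conn_form g (F z) (ebasis R k) = conn_form g (F z) (V z).
Proof.
by move=> Dy; apply: (open_near oD Dy) => z Dz; apply: conn_sum; exact: FU.
Qed.

Let mdiff_conn_basis k y : D y -> mdiff (fun z => conn_form g (F z) (ebasis R k)) y.
Proof.
move=> Dy.
exact: mdiff_comp (dF Dy) (mdiff_conn_form oU sg gpos (ebasis R k) (FU Dy)).
Qed.

Lemma mdiff_conn_along (V : 'rV[R]_2 -> 'rV[R]_m) y : D y -> mdiff V y ->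
  mdiff (fun z => conn_form g (F z) (V z)) y.
Proof.
move=> Dy dV; apply: mdiff_near (conn_sum_near V Dy) _.
apply: (@mdiff_sum _ _ _ _ _
  (fun k z => V z 0 k *: conn_form g (F z) (ebasis R k))) => k.
apply: mdiffZl; first exact: sdiff_entry.
exact: mdiff_conn_basis.
Qed.

Lemma mderive_conn_along i (V : 'rV[R]_2 -> 'rV[R]_m) y : D y -> mdiff V y ->
  mderive (e i) (fun z => conn_form g (F z) (V z)) y =
  mderive (f i y) (conn_form g ^~ (V y)) (F y) +
  conn_form g (F y) (mderive (e i) V y).
Proof.
move=> Dy dV; have dG k := mdiff_conn_form oU sg gpos (ebasis R k) (FU Dy).
rewrite -(mderive_near _ (conn_sum_near V Dy)).
rewrite mderive_sum; last first.
  by move=> k; apply: mdiffZl; [exact: sdiff_entry|exact: mdiff_conn_basis].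
rewrite -(conn_sum _ (FU Dy)).
have -> : mderive (f i y) (conn_form g ^~ (V y)) (F y) =
    \sum_k V y 0 k *: mderive (f i y) (conn_form g ^~ (ebasis R k)) (F y).
  rewrite -(@mderive_near _ _ _ _
    (fun x => \sum_k V y 0 k *: conn_form g x (ebasis R k))); last first.
    by apply: (open_near oU (FU Dy)) => x; exact: conn_sum.
  rewrite mderive_sum => [|k]; last exact: mdiffZ.
  by apply: eq_bigr => k _; rewrite mderiveZ.
rewrite -big_split /=; apply: eq_bigr => k _.
rewrite (mderiveZl _ (sdiff_entry 0 k dV) (mdiff_conn_basis k Dy)).
rewrite (sderive_entry (e i) 0 k dV) (mderive_comp (e i) (dF Dy) (dG k)).
exact: addrC.
Qed.

Lemma cov_tangent_sym i j y : D y -> cov i (f j) y = cov j (f i) y.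
Proof.
move=> Dy; rewrite /cov (smooth_mderive_comm _ _ oD sF Dy).
exact: (congr1 (fun w => _ + w) (conn_form_torsion oU sg gT _ _ (FU Dy))).
Qed.

Lemma mdiff_cov i (V : 'rV[R]_2 -> 'rV[R]_m) y :
  D y -> mdiff V y -> mdiff (mderive (e i) V) y -> mdiff (cov i V) y.
Proof.
move=> Dy dV dDV; apply: mdiffD => //; apply: mdiffM => //.
exact: mdiff_conn_along Dy (mdiff_tangent i Dy).
Qed.

(** The curvature of the pulled-back connection is the pulled-back curvature:
    the derivatives of f_i and f_j that appear on the way cancel, because second
    derivatives of F commute. *)
Lemma cov_comm i j (V : 'rV[R]_2 -> 'rV[R]_m) y : D y -> smooth_on D V ->
  cov i (cov j V) y - cov j (cov i V) y = V y *m curv g (F y) (f i y) (f j y).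
Proof.
move=> Dy sV.
have dV := smooth_mdiff oD sV Dy.
have dDV k : mdiff (mderive (e k) V) y.
  exact: smooth_mdiff oD (smooth_partial k sV) Dy.
have dC k := mdiff_conn_along Dy (mdiff_tangent k Dy).
have E a b : cov a (cov b V) y =
    mderive (e a) (mderive (e b) V) y
    + mderive (e a) V y *m conn_form g (F y) (f b y)
    + V y *m (mderive (f a y) (conn_form g ^~ (f b y)) (F y)
              + conn_form g (F y) (mderive (e a) (f b) y))
    + (mderive (e b) V y + V y *m conn_form g (F y) (f b y))
        *m conn_form g (F y) (f a y).
  rewrite {1}/cov (mderiveD _ (dDV b) (mdiffM dV (dC b))) (mderiveM _ dV (dC b)).
  by rewrite (mderive_conn_along _ Dy (mdiff_tangent b Dy)) addrA.
rewrite !E (smooth_mderive_comm _ _ oD sV Dy).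
rewrite (smooth_mderive_comm _ (e j) oD sF Dy) curvE.
generalize (mderive (e j) (mderive (e i) V) y) (mderive (e i) V y)
  (mderive (e j) V y) (conn_form g (F y) (f i y)) (conn_form g (F y) (f j y))
  (mderive (f i y) (conn_form g ^~ (f j y)) (F y))
  (mderive (f j y) (conn_form g ^~ (f i y)) (F y))
  (conn_form g (F y) (mderive (e j) (f i) y)) => A B C G1 G2 H1 H2 K. 
mx_expand.
Qed.

End AlongSurface.

(** * Parallel mean curvature in isothermal coordinates *)

(** Derivatives go first, because scalar products occur inside them. *)
Ltac gen_scalars :=
  repeat match goal with
  | |- context [@sderive ?S ?k ?v ?h ?x] =>
      generalize (@sderive S k v h x); intro
  | |- context [@bform ?S ?m ?A ?u ?v] => generalize (@bform S m A u v); intro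
  end.

Section IsothermalSurface.
Local Open Scope classical_set_scope.
Local Open Scope ring_scope.
Variables (R : realType) (m : nat) (U : set 'rV[R]_m).
Variables (g phi : 'rV[R]_m -> 'M[R]_m) (xi : 'rV[R]_m -> 'rV[R]_m) (rho : R).
Hypothesis hN : space_form_coordinates U g phi xi rho.
Variables (D : set 'rV[R]_2) (F : 'rV[R]_2 -> 'rV[R]_m).
Hypotheses (oD : open D) (sF : smooth_on D F) (FU : forall y, D y -> U (F y)).

Local Notation e i := (ebasis R (i : 'I_2)).
Local Notation f i := (mderive (e i) F).
Local Notation ip y := (bform (g (F y))).
Local Notation cov := (cov g F).

Variables (E : 'rV[R]_2 -> R) (H : 'rV[R]_2 -> 'rV[R]_m).
Hypothesis conformal : forall y, D y -> forall i j : 'I_2,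
  ip y (f i y) (f j y) = if i == j then E y else 0.
Hypothesis E_neq0 : forall y, D y -> E y != 0.
Hypothesis H_def : forall y, D y ->
  H y = (2 * E y)^-1 *: \sum_k cov k (f k) y.
Hypothesis H_parallel : forall y, D y -> forall i,
  cov i H y = \sum_k ((E y)^-1 * ip y (cov i H y) (f k y)) *: f k y.

Definition shape i j y : R := ip y (cov i (f j) y) (H y).
Definition etaf i y : R := ip y (f i y) (xi (F y)).
Definition phif i y : R := ip y (f i y *m phi (F y)) (H y).
Definition Qcoef i j y : R :=
  8 * ip y (H y) (H y) * shape i j y - rho * ip y (H y) (H y) * etaf i y * etaf j y
  + 3 * rho * phif i y * phif j y.

Ltac gen_coefs :=
  repeat match goal with
  | |- context [shape ?a ?b ?z] => generalize (shape a b z); intro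
  | |- context [etaf ?a ?z] => generalize (etaf a z); intro
  | |- context [phif ?a ?z] => generalize (phif a z); intro
  end;
  gen_scalars.

Let df i y (Dy : D y) : mdiff (f i) y := mdiff_tangent oD sF i Dy.

Let ca y (Dy : D y) := contact_algebra_at hN (FU Dy).

Let ipC y u v : D y -> ip y u v = ip y v u.
Proof. by move=> Dy; exact: ipC (ca Dy) u v. Qed.

Let dcov i j y : D y -> mdiff (cov i (f j)) y.
Proof.
move=> Dy; apply: (mdiff_cov hN oD sF FU Dy (df j Dy)).
exact: smooth_mdiff_mderive oD (smooth_partial j sF) Dy.
Qed.

Let dE y : D y -> sdiff E y.
Proof.
move=> Dy; apply: (@sdiff_near _ _ (fun y => ip y (f ord0 y) (f ord0 y))).
  by apply: (open_near oD Dy) => z Dz; rewrite conformal.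
by apply: (sdiff_ip hN oD sF FU Dy); exact: df.
Qed.

Let dH y : D y -> mdiff H y.
Proof.
move=> Dy; apply: (@mdiff_near _ _ _ _
    (fun z => (2 * E z)^-1 *: \sum_k cov k (f k) z)).
  by apply: (open_near oD Dy) => z Dz; rewrite H_def.
apply: mdiffZl.
  apply: sdiffV; first by rewrite mulf_neq0 ?E_neq0 // pnatr_eq0.
  exact: sdiffM (sdiff_cst _ _) (dE Dy).
by apply: (@mdiff_sum _ _ _ _ _ (fun k => cov k (f k))) => k; exact: dcov.
Qed.

Let dphif i y : D y -> mdiff (fun z => f i z *m phi (F z)) y.
Proof.
move=> Dy; apply: mdiffM (df i Dy) _.
exact (mdiff_along hN oD sF FU Dy (sfc_phi_smooth hN)).
Qed.

Let dxi y : D y -> mdiff (fun z => xi (F z)) y.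
Proof. by move=> Dy; exact (mdiff_along hN oD sF FU Dy (sfc_xi_smooth hN)). Qed.

Let Dip i (V W : 'rV[R]_2 -> 'rV[R]_m) y (Dy : D y) :=
  @derive_ip _ _ _ _ _ _ _ hN _ _ oD sF FU i V W y Dy.

Let dip (V W : 'rV[R]_2 -> 'rV[R]_m) y (Dy : D y) :=
  @sdiff_ip _ _ _ _ _ _ _ hN _ _ oD sF FU V W y Dy.

Let sym i j y (Dy : D y) : cov i (f j) y = cov j (f i) y :=
  cov_tangent_sym hN oD sF FU i j Dy.

Lemma cov_tangent_along i j y : D y ->
  ip y (cov i (f j) y) (f j y) = 2^-1 * sderive (e i) E y.
Proof.
move=> Dy; have DE := Dip i Dy (df j Dy) (df j Dy).
have nE : \forall z \near y, ip z (f j z) (f j z) = E z.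
  by apply: (open_near oD Dy) => z Dz; rewrite conformal // eqxx.
move: (sderive_near (e i) nE) DE (ipC (f j y) (cov i (f j) y) Dy).
by gen_scalars; lra.
Qed.

(** From d_i <f_i, f_j> = 0 and the symmetry cov_i f_j = cov_j f_i. *)
Lemma cov_tangent_across i j y : D y -> i != j ->
  ip y (cov i (f i) y) (f j y) = - (2^-1 * sderive (e j) E y).
Proof.
move=> Dy ij; have DE := Dip i Dy (df i Dy) (df j Dy).
have n0 : \forall z \near y, ip z (f i z) (f j z) = 0.
  by apply: (open_near oD Dy) => z Dz; rewrite conformal // (negbTE ij).
move: (etrans (sderive_near (e i) n0) (sderive_cst 0 (e i) y)) DE.
move: (ipC (f i y) (cov i (f j) y) Dy) (cov_tangent_along j i Dy).
move: (congr1 (fun w => ip y w (f i y)) (sym i j Dy)).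
by gen_scalars; lra.
Qed.

Lemma sum_I2 (V : nmodType) (i j : 'I_2) (G : 'I_2 -> V) :
  i != j -> \sum_k G k = G i + G j.
Proof.
move=> ij; rewrite (bigD1 i) //= (bigD1 j) 1?eq_sym //= big1 ?addr0 // => k.
move: i j k ij => [[|[|[]]] //= ?] [[|[|[]]] //= ?] [[|[|[]]] //= ?].
all: by rewrite -!val_eqE.
Qed.

Let laplace i j y : i != j -> D y ->
  cov i (f i) y + cov j (f j) y = (2 * E y) *: H y.
Proof.
move=> ij Dy; rewrite H_def // (sum_I2 _ ij) scalerA mulfV ?scale1r //.
by rewrite mulf_neq0 ?E_neq0 // pnatr_eq0.
Qed.

(** By conformality the tangential components of cov_i f_i and cov_j f_j are
    opposite. *)
Lemma mean_curvature_normal i j y : i != j -> D y -> ip y (H y) (f i y) = 0.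
Proof.
move=> ij Dy; have E2 : 2 * E y != 0 by rewrite mulf_neq0 ?E_neq0 // pnatr_eq0.
apply: (mulfI E2); rewrite mulr0 -(ipZl (ca Dy)).
rewrite -(laplace ij Dy) (ipDl (ca Dy)).
have ji : j != i by rewrite eq_sym.
move: (cov_tangent_along i i Dy) (cov_tangent_across Dy ji).
by gen_scalars; lra.
Qed.

Section CoordinatePair.
Variables (i j : 'I_2) (ij : i != j).
Let ji : j != i. Proof. by rewrite eq_sym. Qed.

Let H_normal y : D y -> (ip y (H y) (f i y) = 0) * (ip y (H y) (f j y) = 0).
Proof.
move=> Dy.
exact (mean_curvature_normal ij Dy, mean_curvature_normal ji Dy).
Qed.

Let covH_tangent k y : D y ->
  (ip y (cov k H y) (f i y) = - shape k i y) *
  (ip y (cov k H y) (f j y) = - shape k j y).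
Proof.
move=> Dy.
have key l : (forall z, D z -> ip z (H z) (f l z) = 0) ->
    ip y (cov k H y) (f l y) = - shape k l y.
  move=> Hl; have DH := Dip k Dy (dH Dy) (df l Dy).
  have n0 : \forall z \near y, ip z (H z) (f l z) = 0.
    by apply: (open_near oD Dy).
  move: (etrans (sderive_near (e k) n0) (sderive_cst 0 (e k) y)) DH.
  move: (ipC (H y) (cov k (f l) y) Dy); rewrite /shape.
  by gen_scalars; lra.
by split; apply: key => z /H_normal [].
Qed.

Let ip_lin2 y u a b v w : D y ->
  ip y u (a *: v + b *: w) = a * ip y u v + b * ip y u w.
Proof. by move=> Dy; rewrite (ipDr (ca Dy)) !(ipZr (ca Dy)). Qed.

(** The Weingarten equation: parallelism of H in the normal bundle makes cov_k H
    tangent, and differentiating <H, f_l> = 0 gives its components. *)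
Lemma ip_covH k u y : D y -> ip y u (cov k H y) =
  - ((E y)^-1 * (shape k i y * ip y u (f i y) + shape k j y * ip y u (f j y))).
Proof.
move=> Dy; have [Ti Tj] := covH_tangent k Dy.
have := etrans (congr1 (ip y u) (H_parallel Dy k))
  (etrans (congr1 (ip y u) (sum_I2 _ ij)) (ip_lin2 _ _ _ _ _ Dy)).
move: Ti Tj; rewrite /shape; generalize (E y)^-1 => r; gen_scalars.
by move=> -> -> ->; ring.
Qed.

Lemma norm_H_const k y : D y -> sderive (e k) (fun z => ip z (H z) (H z)) y = 0.
Proof.
move=> Dy; have [Hi Hj] := H_normal Dy.
move: (Dip k Dy (dH Dy) (dH Dy)) (ipC (cov k H y) (H y) Dy).
move: (ip_covH k (H y) Dy) Hi Hj; rewrite /shape; generalize (E y)^-1 => r.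
by gen_scalars; move=> -> -> -> -> ->; ring.
Qed.

Let dshape a b y : D y -> sdiff (shape a b) y.
Proof. by move=> Dy; exact (dip Dy (dcov a b Dy) (dH Dy)). Qed.

Let Dshape k a b y : D y -> sderive (e k) (shape a b) y =
  ip y (cov k (cov a (f b)) y) (H y) + ip y (cov a (f b) y) (cov k H y).
Proof. by move=> Dy; exact (Dip k Dy (dcov a b Dy) (dH Dy)). Qed.

Let detaf a y : D y -> sdiff (etaf a) y.
Proof. by move=> Dy; exact (dip Dy (df a Dy) (dxi Dy)). Qed.

Let Detaf k a y : D y ->
  sderive (e k) (etaf a) y = ip y (cov k (f a) y) (xi (F y)).
Proof.
move=> Dy; have E0 : ip y (f a y) (cov k (fun z => xi (F z)) y) = 0.
  rewrite (cov_xi hN oD sF FU k Dy).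
  exact (etrans (ipC (f a y) 0 Dy) (ip0l (ca Dy) (f a y))).
exact (etrans (Dip k Dy (df a Dy) (dxi Dy))
  (etrans (congr1 (fun r => _ + r) E0) (addr0 _))).
Qed.

Let dphif_H a y : D y -> sdiff (phif a) y.
Proof. by move=> Dy; exact (dip Dy (dphif a Dy) (dH Dy)). Qed.

Let Dphif k a y : D y -> sderive (e k) (phif a) y =
  ip y (cov k (f a) y *m phi (F y)) (H y) + ip y (f a y *m phi (F y)) (cov k H y).
Proof.
move=> Dy; rewrite -(cov_phi hN oD sF FU k Dy (df a Dy)).
exact (Dip k Dy (dphif a Dy) (dH Dy)).
Qed.

Let dhh y : D y -> sdiff (fun z => ip z (H z) (H z)) y.
Proof. by move=> Dy; exact (dip Dy (dH Dy) (dH Dy)). Qed.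

Lemma sdiff_Qcoef a b y : D y -> sdiff (Qcoef a b) y.
Proof.
move=> Dy; apply: sdiffD; first apply: sdiffB.
- apply: sdiffM (dshape a b Dy); exact: sdiffM (sdiff_cst _ _) (dhh Dy).
- apply: sdiffM (detaf b Dy); apply: sdiffM (detaf a Dy).
  exact: sdiffM (sdiff_cst _ _) (dhh Dy).
- apply: sdiffM (dphif_H b Dy); apply: sdiffM (dphif_H a Dy); exact: sdiff_cst.
Qed.

Let DQ k a b y : D y -> sderive (e k) (Qcoef a b) y =
  8 * ip y (H y) (H y) * sderive (e k) (shape a b) y
  - rho * ip y (H y) (H y) *
    (sderive (e k) (etaf a) y * etaf b y + etaf a y * sderive (e k) (etaf b) y)
  + 3 * rho *
    (sderive (e k) (phif a) y * phif b y + phif a y * sderive (e k) (phif b) y).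
Proof.
move=> Dy.
exact (sderive_quadratic 8 rho (3 * rho) (dhh Dy) (dshape a b Dy) (detaf a Dy)
  (detaf b Dy) (dphif_H a Dy) (dphif_H b Dy) (norm_H_const k Dy)).
Qed.

Let shape_trace y : D y ->
  shape i i y + shape j j y = 2 * E y * ip y (H y) (H y).
Proof.
move=> Dy; have := congr1 (fun w => ip y w (H y)) (laplace ij Dy).
exact (fun h => etrans (esym (ipDl (ca Dy) _ _ _)) (etrans h (ipZl (ca Dy) _ _ _))).
Qed.

Let shape_sym y : D y -> shape j i y = shape i j y.
Proof. by move=> Dy; rewrite /shape (sym j i Dy). Qed.

Let shape_trace_derive y : D y ->
  sderive (e i) (shape i i) y + sderive (e i) (shape j j) y =
  2 * sderive (e i) E y * ip y (H y) (H y).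
Proof.
move=> Dy; have n0 : \forall z \near y, shape i i z + shape j j z =
    2 * E z * ip z (H z) (H z).
  by apply: (open_near oD Dy); exact: shape_trace.
have d2 := sdiffM (sdiff_cst 2 y) (dE Dy).
move: (sderive_near (e i) n0) (sderiveD (e i) (dshape i i Dy) (dshape j j Dy)).
move: (sderiveM (e i) d2 (dhh Dy)) (sderiveM (e i) (sdiff_cst 2 y) (dE Dy)).
move: (norm_H_const i Dy) (sderive_cst 2 (e i) y).
generalize (E y) => r; gen_scalars.
by move=> -> -> -> -> -> <-; ring.
Qed.

(** The tangential terms of the Codazzi equation: those with d_j E cancel, those
    with d_i E collect the trace 2 E |H|^2 of the second fundamental form in the
    direction H. *)
Let codazzi_algebra (r Ei Ej hh qii qjj qij s1 s2 : R) : r != 0 ->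
  s1 = - (r^-1 * (qii * - (2^-1 * Ei) + qij * (2^-1 * Ej))) ->
  s2 = - (r^-1 * (qij * (2^-1 * Ej) + qjj * (2^-1 * Ei))) ->
  qii + qjj = 2 * r * hh -> s2 - s1 = - (Ei * hh).
Proof.
move=> r0 -> -> tr; have -> : qii = 2 * r * hh - qjj by rewrite -tr addrK.
by field.
Qed.

(** The trace of the shape form is 2 E |H|^2, so d_i of its (i, i) entry is
    traded for d_i of its (j, j) entry. The two remaining second derivatives of
    f_j differ by the curvature. *)
Lemma codazzi y : D y ->
  sderive (e i) (shape i i) y - sderive (e i) (shape j j) y
    + 2 * sderive (e j) (shape i j) y =
  - 2 * ip y (f j y *m curv g (F y) (f i y) (f j y)) (H y).
Proof.
move=> Dy.
have HA : ip y (cov j (f j) y) (cov i H y) =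
    - ((E y)^-1 * (shape i i y * - (2^-1 * sderive (e i) E y)
    + shape i j y * (2^-1 * sderive (e j) E y))).
  move: (ip_covH i (cov j (f j) y) Dy).
  move: (cov_tangent_across Dy ji) (cov_tangent_along j j Dy).
  by generalize (E y)^-1 => r; gen_coefs; move=> -> ->.
have HB : ip y (cov i (f j) y) (cov j H y) =
    - ((E y)^-1 * (shape i j y * (2^-1 * sderive (e j) E y)
    + shape j j y * (2^-1 * sderive (e i) E y))).
  move: (ip_covH j (cov i (f j) y) Dy) (shape_sym Dy) (cov_tangent_along i j Dy).
  move: (congr1 (fun w => ip y w (f i y)) (sym i j Dy)) (cov_tangent_along j i Dy).
  by generalize (E y)^-1 => r; gen_coefs; move=> -> -> -> -> ->.
have AB := codazzi_algebra (E_neq0 Dy) HA HB (shape_trace Dy).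
have subE u v : ip y (u - v) (H y) = ip y u (H y) - ip y v (H y).
  by rewrite (ipDl (ca Dy)) (ipNl (ca Dy)).
have comm := etrans (esym (subE _ _)) (congr1 (fun w => ip y w (H y))
  (cov_comm hN oD sF FU i j Dy (smooth_partial j sF))).
move: {HA HB} comm AB (Dshape i j j Dy) (Dshape j i j Dy) (shape_trace_derive Dy).
by gen_scalars; lra.
Qed.

Let phi_facts y : D y ->
  (ip y (f i y *m phi (F y)) (f i y) = 0) *
  (ip y (f j y *m phi (F y)) (f j y) = 0) *
  (ip y (f i y *m phi (F y)) (f j y) = - ip y (f i y) (f j y *m phi (F y))) *
  (ip y (f j y *m phi (F y)) (f i y) = ip y (f i y) (f j y *m phi (F y))).
Proof.
move=> Dy; have self u : ip y (u *m phi (F y)) u = 0.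
  exact (etrans (ipC _ _ Dy) (ip_phi_self (ca Dy) u)).
exact (self (f i y), self (f j y), phi_skew (ca Dy) (f i y) (f j y), ipC _ _ Dy).
Qed.

(** The normal parts add up to <phi (2 E H), H> = 0; the tangential ones cancel
    because phi is skew and the shape form is symmetric. *)
Let phif_derive_div y : D y ->
  sderive (e i) (phif i) y + sderive (e j) (phif j) y = 0.
Proof.
move=> Dy; have [[[Pii Pjj] Pij] Pji] := phi_facts Dy.
have Hphi0 : ip y (H y *m phi (F y)) (H y) = 0.
  exact (etrans (ipC _ _ Dy) (ip_phi_self (ca Dy) (H y))).
have trace0 : ip y (cov i (f i) y *m phi (F y)) (H y)
    + ip y (cov j (f j) y *m phi (F y)) (H y) = 0.
  apply: etrans (esym (ipDl (ca Dy) _ _ _)) _; rewrite -mxDl (laplace ij Dy) mxZl.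
  by apply: etrans (ipZl (ca Dy) _ _ _) _; rewrite Hphi0 mulr0.
move: trace0 (Dphif i i Dy) (Dphif j j Dy) Pii Pjj Pij Pji (shape_sym Dy).
move: (ip_covH i (f i y *m phi (F y)) Dy) (ip_covH j (f j y *m phi (F y)) Dy).
generalize (E y)^-1 => r; gen_coefs.
by move=> -> -> + -> -> -> -> -> -> -> => /eqP; rewrite addr_eq0 => /eqP ->; ring.
Qed.

(** The normal parts cancel because cov_i f_j = cov_j f_i; the tangential ones
    produce the trace of the shape form. *)
Let phif_derive_curl y : D y ->
  sderive (e j) (phif i) y - sderive (e i) (phif j) y =
  2 * ip y (H y) (H y) * ip y (f i y) (f j y *m phi (F y)).
Proof.
move=> Dy; have [[[Pii Pjj] Pij] Pji] := phi_facts Dy.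
move: (congr1 (fun w => ip y (w *m phi (F y)) (H y)) (sym i j Dy)).
move: (Dphif j i Dy) (Dphif i j Dy) Pii Pjj Pij Pji (shape_sym Dy).
move: (ip_covH j (f i y *m phi (F y)) Dy) (ip_covH i (f j y *m phi (F y)) Dy).
move: (shape_trace Dy) (E_neq0 Dy).
generalize (E y) => r; gen_coefs => /(canRL (addrK _)) -> r0.
by move=> -> -> -> -> -> -> -> -> -> ->; field.
Qed.

(** All terms of the curvature with a factor <f_k, H>, <f_i, f_j> or
    <f_j, phi f_j> vanish. *)
Let curv_H y : D y -> ip y (f j y *m curv g (F y) (f i y) (f j y)) (H y) =
  rho / 4 * (3 * ip y (f i y) (f j y *m phi (F y)) * phif j y
             - E y * etaf i y * ip y (H y) (xi (F y))).
Proof.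
move=> Dy; have [Hi Hj] := H_normal Dy.
have ip_jj : ip y (f j y) (f j y) = E y by rewrite conformal // eqxx.
have ip_ij : ip y (f i y) (f j y) = 0 by rewrite conformal // (negbTE ij).
have self : ip y (f j y) (f j y *m phi (F y)) = 0 := ip_phi_self (ca Dy) (f j y).
have := space_form_curv hN (f i y) (f j y) (f j y) (H y) (FU Dy).
rewrite /space_form_tensor /phif /etaf /=.
move: self ip_jj ip_ij (etrans (ipC _ _ Dy) Hi) (etrans (ipC _ _ Dy) Hj).
generalize (E y) (rho / 4) => r c; gen_scalars.
by move=> -> -> -> -> -> ->; ring.
Qed.

Let etaf_derive_div y : D y ->
  sderive (e i) (etaf i) y + sderive (e j) (etaf j) y
     = 2 * E y * ip y (H y) (xi (F y)).
Proof.
move=> Dy; rewrite (Detaf i i Dy) (Detaf j j Dy).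
apply: etrans (esym (ipDl (ca Dy) _ _ _)) _; rewrite (laplace ij Dy).
exact: (ipZl (ca Dy)).
Qed.

Let etaf_derive_curl y : D y ->
  sderive (e j) (etaf i) y = sderive (e i) (etaf j) y.
Proof. by move=> Dy; rewrite (Detaf j i Dy) (Detaf i j Dy) (sym j i Dy). Qed.

(** The three contributions to the Cauchy-Riemann expression cancel. Here h is
    |H|^2, c is rho, r is E, om is <f_i, phi f_j>, n.. and p.. are the values and
    derivatives of eta(f_k) and of <phi f_k, H>. *)
Let cauchy_riemann_algebra (nj pi h r c om pj ni nH S : R)
    (nii nij nji njj pii pij pji pjj : R) :
  S = - 2 * (c / 4 * (3 * om * pj - r * ni * nH)) ->
  nii + njj = 2 * r * nH -> nji = nij -> pii + pjj = 0 ->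
  pji - pij = 2 * h * om ->
  8 * h * S
  - c * h * (2 * ni * (nii + njj) + 2 * nj * (nji - nij))
  + 3 * c * (2 * pi * (pii + pjj) + 2 * pj * (pji - pij)) = 0.
Proof. by move=> -> -> -> -> ->; field. Qed.

Lemma Qcoef_cauchy_riemann y : D y ->
  sderive (e i) (fun z => Qcoef i i z - Qcoef j j z) y +
  sderive (e j) (fun z => Qcoef i j z + Qcoef j i z) y = 0.
Proof.
move=> Dy.
have dQ a b := sdiff_Qcoef a b Dy.
have nS : \forall z \near y, shape j i z = shape i j z.
  by apply: (open_near oD Dy); exact: shape_sym.
have := cauchy_riemann_algebra (etaf j y) (phif i y)
  (etrans (codazzi Dy) (congr1 (fun w => -2 * w) (curv_H Dy)))
  (etaf_derive_div Dy) (etaf_derive_curl Dy)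
  (phif_derive_div Dy) (phif_derive_curl Dy).
move: (sderiveB (e i) (dQ i i) (dQ j j)) (sderiveD (e j) (dQ i j) (dQ j i)).
move: (DQ i i i Dy) (DQ i j j Dy) (DQ j i j Dy) (DQ j j i Dy).
move: (sderive_near (e j) nS).
generalize (E y); gen_coefs.
move=> r -> -> -> -> -> -> -> <-; ring.
Qed.
End CoordinatePair.
End IsothermalSurface.

(** * Second fundamental form and mean curvature of a conformal immersion *)

Section ConformalExpressions.
Local Open Scope classical_set_scope.
Local Open Scope ring_scope.
Variables (R : realType) (m : nat) (U : set 'rV[R]_m).
Variables (g phi : 'rV[R]_m -> 'M[R]_m) (xi : 'rV[R]_m -> 'rV[R]_m) (rho : R).
Hypothesis hN : space_form_coordinates U g phi xi rho.
Variables (D : set 'rV[R]_2) (F : 'rV[R]_2 -> 'rV[R]_m).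
Hypotheses (oD : open D) (sF : smooth_on D F) (FU : forall y, D y -> U (F y)).

Local Notation e i := (ebasis R (i : 'I_2)).
Local Notation f i := (mderive (e i) F).
Local Notation ip y := (bform (g (F y))).
Local Notation cov := (cov g F).
Local Notation H := (mean_curvature g F).

Variable E : 'rV[R]_2 -> R.
Hypothesis conformal : forall y, D y -> forall i j : 'I_2,
  ip y (f i y) (f j y) = if i == j then E y else 0.
Hypothesis E_neq0 : forall y, D y -> E y != 0.

Let ca y (Dy : D y) := contact_algebra_at hN (FU Dy).

Lemma nabla_along_cov i (V : 'rV[R]_2 -> 'rV[R]_m) y :
  D y -> nabla_along g F (e i) V y = cov i V y.
Proof.
move=> Dy; rewrite /cov.
rewrite -(christoffelE (sfc_open hN) (sfc_g_smooth hN) _ _ (FU Dy)).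
by [].
Qed.

Lemma inv_gram_conformal y i j : D y ->
  inv_gram g F y i j = if i == j then (E y)^-1 else 0.
Proof.
move=> Dy; rewrite /inv_gram.
have -> : \matrix_(i, j) induced_metric g F y (e i) (e j) = (E y)%:M.
  apply/matrixP => a b; rewrite [LHS]mxE [RHS]mxE mulrb.
  exact (conformal Dy a b).
by rewrite invmx_scalar mxE mulrb.
Qed.

Lemma normal_part_conformal y w : D y -> normal_part g F y w =
  w - \sum_k ((E y)^-1 * ip y w (f k y)) *: f k y.
Proof.
move=> Dy; rewrite /normal_part; congr (_ - _); apply: eq_bigr => a _.
rewrite (bigD1 a) //= inv_gram_conformal // eqxx big1 ?addr0 // => b ba.
by rewrite inv_gram_conformal // eq_sym (negbTE ba) mul0r scale0r.
Qed.

Lemma second_fundamental_form_cov i j y : D y ->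
  second_fundamental_form g F y (e i) (e j) = normal_part g F y (cov i (f j) y).
Proof. by move=> Dy; rewrite -nabla_along_cov. Qed.

(** The Gram matrix is E times the identity, so the mean curvature is half the
    normal part of the trace over E; the tangential part of
    cov_1 f_1 + cov_2 f_2 is zero by conformality. *)
Lemma mean_curvature_conformal y : D y ->
  H y = (2 * E y)^-1 *: \sum_k cov k (f k) y.
Proof.
move=> Dy; rewrite /mean_curvature.
pose nf k := normal_part g F y (cov k (f k) y).
have -> : \sum_(i < 2) \sum_(j < 2) inv_gram g F y i j
    *: second_fundamental_form g F y (e i) (e j) = (E y)^-1 *: \sum_k nf k.
  rewrite scaler_sumr; apply: eq_bigr => a _.
  rewrite (bigD1 a) //= inv_gram_conformal // eqxx second_fundamental_form_cov //.
  rewrite big1 ?addr0 //.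
  by move=> b ba; rewrite inv_gram_conformal // eq_sym (negbTE ba) scale0r.
rewrite scalerA invfM; congr (_ *: _).
have d01 : (0 : 'I_2) != 1 by [].
have nfE k : nf k = cov k (f k) y -
    (((E y)^-1 * ip y (cov k (f k) y) (f 0 y)) *: f 0 y +
     ((E y)^-1 * ip y (cov k (f k) y) (f 1 y)) *: f 1 y).
  exact (etrans (normal_part_conformal _ Dy)
    (congr1 (fun w => _ - w) (sum_I2
      (fun l => ((E y)^-1 * ip y (cov k (f k) y) (f l y)) *: f l y) d01))).
apply: etrans (sum_I2 nf d01)
  (etrans _ (esym (sum_I2 (fun k => cov k (f k) y) d01))).
move: (nfE 0) (nfE 1); generalize (nf 0) (nf 1) => n0 n1.
have d10 : (1 : 'I_2) != 0 by [].
move: (cov_tangent_along hN oD sF FU conformal 0 0 Dy).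
move: (cov_tangent_along hN oD sF FU conformal 1 1 Dy).
move: (cov_tangent_across hN oD sF FU conformal Dy d01).
move: (cov_tangent_across hN oD sF FU conformal Dy d10).
generalize (E y)^-1 => r; gen_scalars => -> -> -> -> -> ->.
generalize (cov 0 (f 0) y) (cov 1 (f 1) y) (f 0 y) (f 1 y) => c0 c1 f0 f1.
by apply/rowP => l; rewrite !mxE; ring.
Qed.

Hypothesis parallel_H : forall y, D y -> forall X : 'rV[R]_2,
  nabla_perp g F X H y = 0.

(** The normal part of cov_i H vanishes, so cov_i H equals its tangential part. *)
Lemma mean_curvature_parallel y : D y -> forall i,
  cov i H y = \sum_k ((E y)^-1 * ip y (cov i H y) (f k y)) *: f k y.
Proof.
move=> Dy i; apply/eqP; rewrite -subr_eq0; apply/eqP.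
have := parallel_H Dy (e i); rewrite /nabla_perp (nabla_along_cov _ _ Dy).
by rewrite (normal_part_conformal _ Dy).
Qed.

Let H_normal_all k y : D y -> ip y (f k y) (H y) = 0.
Proof.
move=> Dy; have [i ki] : exists i, k != i.
  by case: (eqVneq k 0) => [->|k0]; [exists 1|exists 0].
have Hk := mean_curvature_normal hN oD sF FU conformal E_neq0
  mean_curvature_conformal ki Dy.
exact (etrans (ca_sym (ca Dy) _ _) Hk).
Qed.

Lemma ip_normal_part w y : D y -> ip y (normal_part g F y w) (H y) = ip y w (H y).
Proof.
move=> Dy; have d01 : (0 : 'I_2) != 1 by [].
rewrite (normal_part_conformal _ Dy).
rewrite (sum_I2 (fun k => ((E y)^-1 * ip y w (f k y)) *: f k y) d01).
have linB u v : ip y (w - (u + v)) (H y) = ip y w (H y) - (ip y u (H y) + ip y v (H y)).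
  by rewrite (ipDl (ca Dy)) (ipNl (ca Dy)) (ipDl (ca Dy)).
have tang0 k r : ip y (r *: f k y) (H y) = 0.
  exact (etrans (ipZl (ca Dy) r (f k y) (H y))
    (etrans (congr1 (fun t => r * t) (H_normal_all k Dy)) (mulr0 r))).
have sub_zeros (a b c' : R) : b = 0 -> c' = 0 -> a - (b + c') = a.
  by move=> -> ->; rewrite addr0 subr0.
exact (etrans (linB _ _) (sub_zeros _ _ _ (tang0 _ _) (tang0 _ _))).
Qed.

Lemma Qcoef_second_fundamental_form i j y : D y ->
  8 * ip y (H y) (H y)
    * ip y (second_fundamental_form g F y (e i) (e j)) (H y)
  - rho * ip y (H y) (H y) * ip y (f i y) (xi (F y)) * ip y (f j y) (xi (F y))
  + 3 * rho * ip y (f i y *m phi (F y)) (H y) * ip y (f j y *m phi (F y)) (H y)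
  = Qcoef g phi xi rho F H i j y.
Proof. by move=> Dy; rewrite (second_fundamental_form_cov i j Dy) (ip_normal_part _ Dy). Qed.
End ConformalExpressions.

(** * The holomorphy condition in real terms *)

Section ComplexForm.
Local Open Scope classical_set_scope.
Local Open Scope ring_scope.
Variable R : realType.

(** With Z = (e_1 - i e_2) / sqrt 2 one has
    2 Q(Z, Z) = (Q_11 - Q_22) - i (Q_12 + Q_21). *)
Lemma Re_Im_20_part (Q : 'rV[R]_2 -> 'rV[R]_2 -> R) :
  complex_bilinear_ext Q (Zvec R) (Zvec R) =
  (2^-1 * (Q (ebasis R 0) (ebasis R 0) - Q (ebasis R 1) (ebasis R 1)) +i*
   - (2^-1 * (Q (ebasis R 0) (ebasis R 1) + Q (ebasis R 1) (ebasis R 0))))%C.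
Proof.
have d01 : (0 : 'I_2) != 1 by [].
rewrite /complex_bilinear_ext (sum_I2 _ d01) !(sum_I2 _ d01) !mxE /=.
generalize (Q (ebasis R 0) (ebasis R 0)) (Q (ebasis R 0) (ebasis R 1))
  (Q (ebasis R 1) (ebasis R 0)) (Q (ebasis R 1) (ebasis R 1)) => a b c d.
have s2 : (Num.sqrt 2)^-1 * (Num.sqrt 2)^-1 = 2^-1 :> R.
  by rewrite -invfM -expr2 sqr_sqrtr.
move: s2; generalize (Num.sqrt 2 : R)^-1 => s s2.
by apply/eqP; rewrite eq_complex /= -s2; apply/andP; split; apply/eqP; ring.
Qed.

Lemma cauchy_riemann_complex_deriv (h : 'rV[R]_2 -> R[i]) (a b : 'rV[R]_2 -> R) y :
  (forall z, h z = (a z +i* b z)%C) ->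
  sderive (ebasis R 0) a y = sderive (ebasis R 1) b y ->
  sderive (ebasis R 1) a y = - sderive (ebasis R 0) b y ->
  complex_deriv (Zhatvec R) h y = 0.
Proof.
move=> hab; have -> : h = (fun z => (a z +i* b z)%C) by apply/funext.
have d01 : (0 : 'I_2) != 1 by [].
pose G j := Zhatvec R 0 j *
  (sderive (ebasis R j) a y +i* sderive (ebasis R j) b y)%C.
have -> : complex_deriv (Zhatvec R) (fun z => (a z +i* b z)%C) y = G 0 + G 1.
  exact (sum_I2 G d01).
rewrite /G !mxE /=.
generalize (Num.sqrt 2 : R)^-1 => r; gen_scalars => -> ->.
by apply/eqP; rewrite eq_complex /=; apply/andP; split; apply/eqP; ring.
Qed.
Lemma holomorphic_20_at (Q : 'rV[R]_2 -> 'rV[R]_2 -> 'rV[R]_2 -> R) y :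
  (forall i j, sdiff (fun z => Q z (ebasis R i) (ebasis R j)) y) ->
  (forall i j : 'I_2, i != j ->
    sderive (ebasis R i) (fun z => Q z (ebasis R i) (ebasis R i)
                                   - Q z (ebasis R j) (ebasis R j)) y +
    sderive (ebasis R j) (fun z => Q z (ebasis R i) (ebasis R j)
                                   + Q z (ebasis R j) (ebasis R i)) y = 0) ->
  let h z := complex_bilinear_ext (Q z) (Zvec R) (Zvec R) in
  [/\ differentiable (fun z => complex.Re (h z)) y,
      differentiable (fun z => complex.Im (h z)) y &
      complex_deriv (Zhatvec R) h y = 0].
Proof.
move=> dQ CR h.
pose q i j z := Q z (ebasis R i) (ebasis R j).
pose a z := 2^-1 * (q 0 0 z - q 1 1 z).
pose b z := - 1 * (2^-1 * (q 0 1 z + q 1 0 z)).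
have hab : h = (fun z => (a z +i* b z)%C).
  by apply/funext => z; rewrite /h Re_Im_20_part /b mulN1r.
have dZ c (w : 'rV[R]_2 -> R) v : sdiff w y ->
    sdiff (fun z => c * w z) y /\
    sderive v (fun z => c * w z) y = c * sderive v w y.
  move=> dw; split; first exact: sdiffM (sdiff_cst _ _) dw.
  by rewrite (sderiveM v (sdiff_cst c y) dw) sderive_cst mul0r add0r.
have dd : sdiff (fun z => q 0 0 z - q 1 1 z) y := sdiffB (dQ 0 0) (dQ 1 1).
have ds : sdiff (fun z => q 0 1 z + q 1 0 z) y := sdiffD (dQ 0 1) (dQ 1 0).
have da : sdiff a y := (dZ 2^-1 _ 0 dd).1.
have db : sdiff b y := (dZ (- 1) _ 0 (dZ 2^-1 _ 0 ds).1).1.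
have Da v : sderive v a y = 2^-1 * sderive v (fun z => q 0 0 z - q 1 1 z) y.
  exact: (dZ _ _ v dd).2.
have Db v : sderive v b y = - 1 * (2^-1 * sderive v (fun z => q 0 1 z + q 1 0 z) y).
  exact (etrans (dZ _ _ v (dZ 2^-1 _ v ds).1).2
    (congr1 (fun t => - 1 * t) (dZ _ _ v ds).2)).
have CR01 : sderive (ebasis R 0) (fun z => q 0 0 z - q 1 1 z) y
    + sderive (ebasis R 1) (fun z => q 0 1 z + q 1 0 z) y = 0 by exact: CR.
have CR10 : sderive (ebasis R 1) (fun z => q 0 0 z - q 1 1 z) y
    - sderive (ebasis R 0) (fun z => q 0 1 z + q 1 0 z) y = 0.
  have N1 : sderive (ebasis R 1) (fun z => q 1 1 z - q 0 0 z) y =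
      - sderive (ebasis R 1) (fun z => q 0 0 z - q 1 1 z) y.
    have -> : (fun z => q 1 1 z - q 0 0 z) = (fun z => - 1 * (q 0 0 z - q 1 1 z)).
      by apply/funext => z; rewrite mulN1r opprB.
    by rewrite (dZ _ _ _ dd).2 mulN1r.
  have N2 : sderive (ebasis R 0) (fun z => q 1 0 z + q 0 1 z) y =
      sderive (ebasis R 0) (fun z => q 0 1 z + q 1 0 z) y.
    have -> // : (fun z => q 1 0 z + q 0 1 z) = (fun z => q 0 1 z + q 1 0 z).
    by apply/funext => z; rewrite addrC.
  have d10 : (1 : 'I_2) != 0 by [].
  have C10 : sderive (ebasis R 1) (fun z => q 1 1 z - q 0 0 z) y
      + sderive (ebasis R 0) (fun z => q 1 0 z + q 0 1 z) y = 0 := CR 1 0 d10.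
  by move: C10 N1 N2; gen_scalars; lra.
rewrite hab; split; [exact: da|exact: db|].
apply: (@cauchy_riemann_complex_deriv _ a b) => //.
  by move: (Da (ebasis R 0)) (Db (ebasis R 1)) CR01; gen_scalars; lra.
by move: (Da (ebasis R 1)) (Db (ebasis R 0)) CR10; gen_scalars; lra.
Qed.
End ComplexForm.

(** * From charts to the manifolds *)

Section Charts.
Local Open Scope classical_set_scope.
Local Open Scope ring_scope.
Variable R : realType.

(** A chart is a homeomorphism onto its open image, so it carries the open set
    where the local expression makes sense to an open set. *)
Lemma open_local_dom k m (Sig : manifold R k) (N : manifold R m) (f : Sig -> N)
    s c : continuous f -> open (local_dom f s c).
Proof.
move=> cf.
have oA : open (cdom s `&` f @^-1` cdom c).
  by apply: openI; [exact: cdom_open|exact: open_comp (fun p _ => cf p) (cdom_open c)].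
rewrite openE => _ [p [sp fp] <-].
have sx : cimg s (cmap s p) by exists p.
have near_img := near_of_open (@cimg_open _ _ _ s) sx.
have near_A : \forall z \near cmap s p, (cdom s `&` f @^-1` cdom c) (cinv s z).
  apply: (cinv_continuous sx); rewrite cmapK //.
  by apply: open_nbhs_nbhs; split.
near=> z; have [q sq qz] : cimg s z by near: z.
exists q => //; have : (cdom s `&` f @^-1` cdom c) (cinv s z) by near: z.
by rewrite -qz cmapK.
Unshelve. all: by end_near. Qed.

Lemma local_map_dom k m (Sig : manifold R k) (N : manifold R m) (f : Sig -> N)
    s c y : local_dom f s c y -> cimg c (local_map f s c y).
Proof. by move=> [p [sp fp] <-]; exists (f p) => //; rewrite /local_map /= cmapK. Qed.

Lemma local_dom_cimg k m (Sig : manifold R k) (N : manifold R m) (f : Sig -> N)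
    s c y : local_dom f s c y -> cimg s y.
Proof. by move=> [p [sp _] <-]; exists p. Qed.

(** The parallelism of phi is tested on constant fields X = u and Y = w, which
    determines the derivative of the matrix of phi. *)
Lemma space_form_chart m (N : manifold R m) (g : riemannian_metric N)
    (S : almost_contact_tensors N) rho c :
  cosymplectic_space_form g S rho -> atlas c ->
  space_form_coordinates (cimg c) (g c) (phimx S c) (xivec S c) rho.
Proof.
move=> [[acm par] hol] Ac.
have oU : open (cimg c) := @cimg_open _ _ _ c.
have sg := gmx_smooth g Ac; have sphi := phimx_smooth S Ac.
split=> //.
- exact: xivec_smooth.
- by move=> x; exact: gmx_sym.
- by move=> x; exact: gmx_pos.
- by move=> x; exact: acm.
- move=> x u Ux; apply/row_matrixP => i; rewrite !rowE.
  have := par c Ac (fun=> u) (fun=> delta_mx 0 i) (smooth_cst _ _) (smooth_cst _ _) x Ux.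
  rewrite !nablaE mderive_cst add0r.
  rewrite (mderiveM _ (mdiff_cst _ _) (smooth_mdiff oU sphi Ux)) mderive_cst mx0l add0r.
  rewrite !(christoffelE oU sg _ _ Ux) mxDr mxNr !mxA => /eqP.
  by rewrite subr_eq0 => /eqP <-; rewrite addrK.
- by move=> x; exact: hol.
Qed.
End Charts.

Theorem theorem3p2 (R : realType) (n : nat) (rho : R)
    (N : manifold R (2 * n).+1) (g : riemannian_metric N)
    (S : almost_contact_tensors N) (Sig : manifold R 2) (f : Sig -> N) :
  cosymplectic_space_form g S rho ->
  pmc_surface g f ->
  holomorphic_20_part g f (Qform g S rho f).
Proof.
move=> hS [[cf imm] pmc] s c As [lambda lambda_gt0 iso] Ac y Dy.
have hN := space_form_chart hS Ac.
have oD : open (local_dom f s c) := open_local_dom cf.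
have sF := (imm s c As Ac).1.
have FU z : local_dom f s c z -> cimg c (local_map f s c z).
  exact: local_map_dom.
pose F := local_map f s c; pose E z := (lambda z ^+ 2)%R.
pose H := mean_curvature (g c) F.
have conformal z : local_dom f s c z -> forall i j : 'I_2,
    bform (g c (F z)) (mderive (ebasis R i) F z) (mderive (ebasis R j) F z) =
    (if i == j then E z else 0)%R.
  move=> Dz i j; apply: etrans (iso c Ac z Dz (ebasis R i) (ebasis R j)) _.
  rewrite /ebasis !mxE /E.
  move: i j => [[|[|[]]] //= ?] [[|[|[]]] //= ?];
    by rewrite ?(mulr0, mul0r, mulr1, addr0, add0r).
have E_neq0 z : local_dom f s c z -> (E z != 0)%R.
  by move=> Dz; rewrite expf_neq0 // gt_eqF // lambda_gt0 //; exact: local_dom_cimg Dz.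
have Hdef := mean_curvature_conformal hN oD sF FU conformal.
have Hpar := mean_curvature_parallel hN FU conformal (pmc s c As Ac).
have nQ i j : \forall z \near y, Qcoef (g c) (phimx S c) (xivec S c) rho F H i j z =
    Qform g S rho f s c z (ebasis R i) (ebasis R j).
  apply: (open_near oD Dy) => z Dz; apply/esym.
  exact (Qcoef_second_fundamental_form hN oD sF FU conformal E_neq0 i j Dz).
apply: holomorphic_20_at => [i j|i j ij].
  apply: sdiff_near (nQ i j) _.
  exact (sdiff_Qcoef hN oD sF FU conformal E_neq0 Hdef i j Dy).
have nB : \forall z \near y,
    (Qcoef (g c) (phimx S c) (xivec S c) rho F H i i z
     - Qcoef (g c) (phimx S c) (xivec S c) rho F H j j z)%R =
    (Qform g S rho f s c z (ebasis R i) (ebasis R i)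
     - Qform g S rho f s c z (ebasis R j) (ebasis R j))%R.
  by move: (nQ i i) (nQ j j); apply: filterS2 => z -> ->.
have nD : \forall z \near y,
    (Qcoef (g c) (phimx S c) (xivec S c) rho F H i j z
     + Qcoef (g c) (phimx S c) (xivec S c) rho F H j i z)%R =
    (Qform g S rho f s c z (ebasis R i) (ebasis R j)
     + Qform g S rho f s c z (ebasis R j) (ebasis R i))%R.
  by move: (nQ i j) (nQ j i); apply: filterS2 => z -> ->.
rewrite -(sderive_near _ nB) -(sderive_near _ nD).
exact (Qcoef_cauchy_riemann hN oD sF FU conformal E_neq0 Hdef Hpar ij Dy).
Qed.
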